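(* Let $\mu=(\mu_1\ge\cdots\ge\mu_p\ge0)$ be a partition and $\mathbf w=(w_1,\dots,w_p)\in H_\ell^p$. Then $\mathrm{inv}$ restricts to a bijection \[ \{T\in\mathrm{Tabloids}_\ell(\mu):T\text{ is }\mathbf w\text{-katabolizable}\}\ \longrightarrow\ \mathcal B^{\mu;\mathbf w}, \] which takes shape to content.
   Context: Tabloids: rows $1..\ell$ (top to bottom), of lengths $\alpha_1,\dots,\alpha_\ell$ (the shape), weakly increasing positive entries; $\mathrm{Tabloids}_\ell(\mu)$ those of content $\mu$ ($\mu_j$ entries equal to $j$). $P_j(T)$ ($j\in[\ell-1]$) replaces rows $j,j+1$ by the Schensted insertion tableau of $T^{j+1}T^j$. $H_\ell$: 0-Hecke monoid on $\bar s_1,\dots,\bar s_{\ell-1}$ ($\bar s_i^2=\bar s_i$, commutation, braid); $P_w=P_{i_1}\cdots P_{i_m}$ for $w=\bar s_{i_1}\cdots\bar s_{i_m}$, $w^{-1}=\bar s_{i_m}\cdots\bar s_{i_1}$. $\mathrm{kat}(T)$: remove 1's, left-justify, move row 1 to row $\ell$, subtract 1 from all entries. $T$ is $(w_1,\dots,w_r)$-katabolizable if all 1's of $P_{w_1^{-1}}(T)$ are in its first row and $\mathrm{kat}(P_{w_1^{-1}}(T))$ is $(w_2,\dots,w_r)$-katabolizable; for the empty sequence only the empty tabloid qualifies. $B^{1,s}$: weakly increasing words of length $s$ in $[\ell]$. For $i\in I=\mathbb{Z}/\ell\mathbb{Z}$ and $v\in B^{1,s}$: if $i\ne0$, $\varphi_i(v)$=#$i$'s,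 $\varepsilon_i(v)$=#$(i+1)$'s, $\tilde f_i$ changes the rightmost $i$ to $i+1$; if $i=0$, $\varphi_0$=#$\ell$'s, $\varepsilon_0$=#1's, $\tilde f_0$ removes an $\ell$ from the end and adds a 1 at the beginning ($0$ when impossible). $\mathcal B^\mu=B^{1,\mu_p}\otimes\cdots\otimes B^{1,\mu_1}$, elements $b=b^p\otimes\cdots\otimes b^1$. $\tilde f_i b$: write, for $j=p,\dots,1$ left to right, $\varphi_i(b^j)$ symbols '')'' followed by $\varepsilon_i(b^j)$ symbols ''(''; match each ''('' with a later '')''; apply $\tilde f_i$ to the factor containing the rightmost unmatched '')'' ($0$ if none). $\mathcal F_iS=\{\tilde f_i^mb:b\in S,m\ge0\}\setminus\{0\}$, $\mathcal F_w=\mathcal F_{j_1}\cdots\mathcal F_{j_k}$ for $w=\bar s_{j_1}\cdots\bar s_{j_k}$ (independent of the expression). $\mathcal F_\tau$ adds 1 mod $\ell$ to every letter ($\ell\mapsto1$) and re-sorts each factor. $\mathsf b_s=1^s$. DARK crystal: $\mathcal B^{\mu;\mathbf w}=\mathcal F_{w_1}\big(\mathcal F_\tau\mathcal F_{w_2}\big(\cdots\mathcal F_\tau\mathcal F_{w_p}\{\mathsf b_{\mu_p}\}\otimes\mathsf b_{\mu_{p-1}}\cdots\big)\otimes\mathsf b_{\mu_1}\big)\subset\mathcal B^\mu$ (where $S\otimes\mathsf b=\{s\otimes\mathsf b:s\in S\}$). The content of $b$ is the vector counting letters $1,\dots,\ell$ in all factors. $\mathrm{inv}:\mathcal B^\mu\to\mathrm{Tabloids}_\ell(\mu)$: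 row $i$ of $\mathrm{inv}(b)$ lists each $j$ as many times as $i$ occurs in $b^j$, sorted. *)

(* Defs.v *)
From HB Require Import structures.
From mathcomp Require Import all_boot all_order.
From mathcomp Require Import generic_quotient.
From mathcomp Require Import boolp classical_sets functions.

Set Implicit Arguments.
Unset Strict Implicit.
Unset Printing Implicit Defensive.

Local Open Scope quotient_scope.
Local Open Scope classical_set_scope.

(* The letter [i : 'I_l.-1] stands for the generator s_(i+1). *)
Notation hecke_word l := (seq 'I_l.-1).

Inductive hecke_relation (l : nat) : hecke_word l -> hecke_word l -> Prop :=
| hecke_idem i : hecke_relation [:: i; i] [:: i]
| hecke_comm (i j : 'I_l.-1) of i.+1 < j : hecke_relation [:: i; j] [:: j; i]
| hecke_braid (i j : 'I_l.-1) of j = i.+1 :> nat :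
    hecke_relation [:: i; j; i] [:: j; i; j].

Inductive hecke_cong (l : nat) : hecke_word l -> hecke_word l -> Prop :=
| hecke_rel u v of hecke_relation u v : hecke_cong u v
| hecke_refl u : hecke_cong u u
| hecke_sym u v of hecke_cong u v : hecke_cong v u
| hecke_trans u v x of hecke_cong u v & hecke_cong v x : hecke_cong u x
| hecke_cat u u' v v' of hecke_cong u u' & hecke_cong v v' :
    hecke_cong (u ++ v) (u' ++ v').

Definition hecke_congb l : rel (hecke_word l) := fun u v => `[< hecke_cong u v >].

Lemma hecke_congb_refl l : reflexive (@hecke_congb l).
Proof. by move=> u; apply/asboolP; exact: hecke_refl. Qed.

Lemma hecke_congb_sym l : symmetric (@hecke_congb l).
Proof. by move=> u v; apply/asboolP/asboolP; exact: hecke_sym. Qed.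

Lemma hecke_congb_trans l : transitive (@hecke_congb l).
Proof.
by move=> v u x /asboolP uv /asboolP vx; apply/asboolP; exact: hecke_trans uv vx.
Qed.

Canonical hecke_equiv l :=
  EquivRel _ (@hecke_congb_refl l) (@hecke_congb_sym l) (@hecke_congb_trans l).

Definition hecke (l : nat) : Type := {eq_quot (hecke_equiv l)}.
HB.instance Definition _ l := Choice.on (hecke l).
HB.instance Definition _ l := EqQuotient.on (hecke l).

Section HeckeMonoid.
Variable l : nat.
Implicit Types (u v : hecke_word l) (x y z w : hecke l).

Lemma hecke_piP u v : \pi_(hecke l) u = \pi_(hecke l) v <-> hecke_cong u v.
Proof.
split; first by move/eqmodP/asboolP.
by move=> uv; apply/eqmodP/asboolP.
Qed.

Lemma hecke_repr_pi u : hecke_cong (repr (\pi_(hecke l) u)) u.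
Proof. by apply/hecke_piP; rewrite reprK. Qed.

Definition hecke_one : hecke l := \pi_(hecke l) [::].
Definition hecke_mul x y : hecke l := \pi_(hecke l) (repr x ++ repr y).

Lemma hecke_mul_pi u v :
  hecke_mul (\pi_(hecke l) u) (\pi_(hecke l) v) = \pi_(hecke l) (u ++ v).
Proof. by apply/hecke_piP/hecke_cat; exact: hecke_repr_pi. Qed.

Lemma hecke_mulA : associative hecke_mul.
Proof.
elim/quotW=> x; elim/quotW=> y; elim/quotW=> z.
by rewrite (hecke_mul_pi y z) (hecke_mul_pi x y) !hecke_mul_pi catA.
Qed.

Lemma hecke_mul1 : left_id hecke_one hecke_mul.
Proof. by elim/quotW=> x; rewrite hecke_mul_pi. Qed.

Lemma hecke_mulr1 : right_id hecke_one hecke_mul.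
Proof. by elim/quotW=> x; rewrite hecke_mul_pi cats0. Qed.

HB.instance Definition _ :=
  isMonoid.Build (hecke l) hecke_mulA hecke_mul1 hecke_mulr1.

Definition hecke_gen (i : 'I_l.-1) : hecke l := \pi_(hecke l) [:: i].

Lemma hecke_pi_prod u : \pi_(hecke l) u = (\prod_(i <- u) hecke_gen i)%g.
Proof.
elim: u => [|i u IH]; first by rewrite big_nil.
by rewrite big_cons -IH; exact/esym/(hecke_mul_pi [:: i] u).
Qed.

Lemma hecke_repr_prod w : (\prod_(i <- repr w) hecke_gen i)%g = w.
Proof. by rewrite -hecke_pi_prod reprK. Qed.

(* The anti-automorphism written w^-1, fixing every generator. *)
Definition hecke_rev w : hecke l := \pi_(hecke l) (rev (repr w)).

Lemma hecke_cong_rev u v : hecke_cong u v -> hecke_cong (rev u) (rev v).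
Proof.
elim=> {u v} [u v [i|i j ij|i j ij]|u|u v _|u v t _ uv _|u u' v v' _ uu' _ vv'].
- exact/hecke_rel/hecke_idem.
- exact/hecke_sym/hecke_rel/hecke_comm.
- exact/hecke_rel/hecke_braid.
- exact: hecke_refl.
- exact: hecke_sym.
- exact: hecke_trans.
- by rewrite !rev_cat; exact: hecke_cat.
Qed.

Lemma hecke_rev_pi u : hecke_rev (\pi_(hecke l) u) = \pi_(hecke l) (rev u).
Proof. by apply/hecke_piP/hecke_cong_rev; exact: hecke_repr_pi. Qed.

End HeckeMonoid.

Definition tabloid (l : nat) : Type := l.-tuple (seq nat).

Definition is_tabloid l (T : tabloid l) : bool :=
  all (fun r => sorted leq r && all (leq 1) r) T.

Definition tabloid_shape l (T : tabloid l) : seq nat := [seq size r | r <- T].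

(* [nth 0 mu j.-1] is the j-th part of mu, and 0 past the end of mu. *)
Definition Tabloids (l : nat) (mu : seq nat) : set (tabloid l) :=
  [set T | is_tabloid T /\
     forall j, 0 < j -> count_mem j (flatten T) = nth 0 mu j.-1].
Arguments Tabloids : clear implicits.

Fixpoint row_insert (x : nat) (r : seq nat) : option nat * seq nat :=
  if r is y :: r' then
    if x < y then (Some y, x :: r')
    else let: (bumped, r'') := row_insert x r' in (bumped, y :: r'')
  else (None, [:: x]).

Fixpoint tableau_insert (x : nat) (t : seq (seq nat)) : seq (seq nat) :=
  if t is r :: t' then
    let: (bumped, r') := row_insert x r in
    r' :: (if bumped is Some y then tableau_insert y t' else t')
  else [:: [:: x]].

Definition insertion_tableau (u : seq nat) : seq (seq nat) :=
  foldl (fun t x => tableau_insert x t) [::] u.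

(* Rows are 0-based: this is P_(j+1) and acts on the rows [j] and [j.+1]. The
   insertion tableau of a product of two weakly increasing words has at most
   two rows; rows it lacks are empty. *)
Definition P_row l (j : nat) (T : tabloid l) : tabloid l :=
  let Q := insertion_tableau (nth [::] T j.+1 ++ nth [::] T j) in
  [tuple if i == j :> nat then nth [::] Q 0
         else if i == j.+1 :> nat then nth [::] Q 1
         else tnth T i | i < l].

(* The operators do not depend on the expression of w, so the one picked by
   [repr] is used, both here and in [Fset_hecke] below. *)
Definition P_hecke l (w : hecke l) (T : tabloid l) : tabloid l :=
  foldr (fun (i : 'I_l.-1) U => P_row i U) T (repr w).

Definition kat l (T : tabloid l) : tabloid l :=
  [tuple [seq a.-1 | a <- nth [::] T (i.+1 %% l) & a != 1] | i < l].

Fixpoint katabolizable l (w : seq (hecke l)) (T : tabloid l) : bool :=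
  if w is w1 :: w' then
    let U := P_hecke (hecke_rev w1) T in
    [forall i : 'I_l, (1 \in tnth U i) ==> (i == 0 :> nat)]
    && katabolizable w' (kat U)
  else all (pred1 [::]) T.

(* [b = b^p (x) ... (x) b^1] is the list [:: b^1; ...; b^p], so that
   [nth [::] b j.-1] is b^j. *)
Definition crystal_elt : Type := seq (seq nat).

Definition is_B1 (l s : nat) (v : seq nat) : bool :=
  [&& size v == s, sorted leq v & all (fun a => 1 <= a <= l) v].

Definition Bmu (l : nat) (mu : seq nat) : set crystal_elt :=
  [set b | size b = size mu /\
     forall j, j < size mu -> is_B1 l (nth 0 mu j) (nth [::] b j)].

Section Crystal.
Variable l : nat.

(* In this section [i < l] is the residue of i in Z/lZ. *)
Definition phi (i : nat) (v : seq nat) : nat :=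
  count_mem (if i == 0 then l else i) v.

Definition epsilon (i : nat) (v : seq nat) : nat := count_mem i.+1 v.

Definition f_row (i : nat) (v : seq nat) : option (seq nat) :=
  if i == 0 then
    if l \in v then Some (1 :: take (size v).-1 v) else None
  else
    if i \in v then Some (rev (set_nth 0 (rev v) (index i (rev v)) i.+1))
    else None.

(* [true] is "(" and [false] is ")"; the second component records the factor. *)
Definition brackets (i : nat) (b : crystal_elt) : seq (bool * nat) :=
  flatten [seq nseq (phi i (nth [::] b j)) (false, j)
            ++ nseq (epsilon i (nth [::] b j)) (true, j)
          | j <- rev (iota 0 (size b))].

(* The unmatched ")", left to right; [n] counts the pending "(". *)
Fixpoint unmatched (n : nat) (s : seq (bool * nat)) : seq nat :=
  match s with
  | [::] => [::]
  | (true, _) :: s' => unmatched n.+1 s'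
  | (false, j) :: s' =>
      if n is n'.+1 then unmatched n' s' else j :: unmatched 0 s'
  end.

Definition f_op (i : nat) (b : crystal_elt) : option crystal_elt :=
  if rev (unmatched 0 (brackets i b)) is j :: _ then
    omap (set_nth [::] b j) (f_row i (nth [::] b j))
  else None.

Definition Fset (i : nat) (S : set crystal_elt) : set crystal_elt :=
  [set b' | exists2 b, S b & exists m, iter m (obind (f_op i)) (Some b) = Some b'].

Definition Fset_hecke (w : hecke l) (S : set crystal_elt) : set crystal_elt :=
  foldr (fun (i : 'I_l.-1) A => Fset i.+1 A) S (repr w).

Definition tau (b : crystal_elt) : crystal_elt :=
  [seq sort leq [seq if a == l then 1 else a.+1 | a <- v] | v <- b].

Definition tensor_b (S : set crystal_elt) (s : nat) : set crystal_elt :=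
  [set nseq s 1 :: b | b in S].

Fixpoint dark (mu : seq nat) (w : seq (hecke l)) : set crystal_elt :=
  match mu, w with
  | m :: mu', w1 :: w' => Fset_hecke w1 (tensor_b (tau @` dark mu' w') m)
  | _, _ => [set [::]]
  end.

Definition content (b : crystal_elt) : seq nat :=
  [seq count_mem i (flatten b) | i <- iota 1 l].

Definition crystal_inv (b : crystal_elt) : tabloid l :=
  [tuple flatten [seq nseq (count_mem i.+1 (nth [::] b j.-1)) j
                 | j <- iota 1 (size b)] | i < l].

(* The inverse of [crystal_inv] on tabloids with entries at most [p]: b^j lists
   each i
   as many times as j occurs in row i. *)
Definition tabloid_inv (p : nat) (T : tabloid l) : crystal_elt :=
  [seq flatten [seq nseq (count_mem j (nth [::] T i.-1)) i | i <- iota 1 l]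
  | j <- iota 1 p].

End Crystal.

Lemma count_nseq_flatten (F : nat -> nat) (a : nat) (s : seq nat) : uniq s ->
  count_mem a (flatten [seq nseq (F j) j | j <- s]) = (a \in s) * F a.
Proof.
elim: s => //= j s IH /andP[js us].
rewrite count_cat count_nseq {}IH //= inE [a == j]eq_sym.
by case: eqVneq => [<-|_] //=; rewrite (negbTE js) mul0n addn0.
Qed.

Lemma sorted_nseq_flatten (F : nat -> nat) m n :
  sorted leq (flatten [seq nseq (F j) j | j <- iota m n]).
Proof.
rewrite (sorted_pairwise leq_trans).
elim: n m => //= n IH m; rewrite pairwise_cat IH andbT; apply/andP; split.
  apply/allrelP => x y /nseqP[-> _] /flatten_mapP[j].
  by rewrite mem_iota => /andP[mj _] /nseqP[-> _]; exact: ltnW.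
by elim: (F m) => //= k ->; rewrite andbT; apply/allP => x /nseqP[->].
Qed.

Lemma sorted_count_eq (s t : seq nat) : sorted leq s -> sorted leq t ->
  (forall a, count_mem a s = count_mem a t) -> s = t.
Proof.
move=> ss st e; apply: (sorted_eq leq_trans anti_leq) => //.
by apply/allP => a _ /=; apply/eqP; exact: e.
Qed.

Lemma size_count_iota l (v : seq nat) : all (fun a => 1 <= a <= l) v ->
  \sum_(i < l) count_mem i.+1 v = size v.
Proof.
elim: v => [_|a v IH /= /andP[/andP[a1 al] vl]]; first by rewrite big1.
rewrite big_split /= IH // -add1n; congr (_ + _).
have al' : a.-1 < l by rewrite prednK.
rewrite (bigD1 (Ordinal al')) //= prednK // eqxx big1 ?addn0 // => i /eqP ni.
by case: eqP => // e; case: ni; apply/val_inj; rewrite /= e.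
Qed.

Lemma count_mem_flatten_tuple l (T : tabloid l) a :
  count_mem a (flatten T) = \sum_(i < l) count_mem a (tnth T i).
Proof. by rewrite count_flatten sumnE big_map big_tuple. Qed.

Lemma nth_tabloid l (T : tabloid l) (i : 'I_l) : nth [::] T i = tnth T i.
Proof. by rewrite (tnth_nth [::]). Qed.

Section InvBij.
Variables (l : nat) (mu : seq nat).

Lemma count_crystal_inv (b : crystal_elt) (i : 'I_l) j : 0 < j ->
  count_mem j (tnth (crystal_inv l b) i) = count_mem i.+1 (nth [::] b j.-1).
Proof.
move=> j0; rewrite tnth_mktuple
  (count_nseq_flatten (fun j => count_mem i.+1 (nth [::] b j.-1))) ?iota_uniq //.
rewrite mem_iota j0 add1n ltnS /=.
case: leqP => [_|sj]; first by rewrite mul1n.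
by rewrite mul0n nth_default // -ltnS prednK.
Qed.

Lemma count_tabloid_inv p (T : tabloid l) j (i : 'I_l) : j < p ->
  count_mem i.+1 (nth [::] (tabloid_inv p T) j) = count_mem j.+1 (tnth T i).
Proof.
move=> jp; rewrite (nth_map 0) ?size_iota // nth_iota // add1n.
rewrite (count_nseq_flatten (fun i => count_mem j.+1 (nth [::] T i.-1)))
  ?iota_uniq //.
by rewrite mem_iota /= add1n ltnS ltn_ord mul1n nth_tabloid.
Qed.

Lemma crystal_inv_Tabloids b : Bmu l mu b -> Tabloids l mu (crystal_inv l b).
Proof.
move=> [sb Bb]; split.
  apply/allP => r /tnthP[i ->]; apply/andP; split.
    by rewrite tnth_mktuple sorted_nseq_flatten.
  apply/allP => a; rewrite tnth_mktuple => /flatten_mapP[j].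
  by rewrite mem_iota => /andP[j0 _] /nseqP[->].
move=> j j0; rewrite count_mem_flatten_tuple.
under eq_bigr do rewrite count_crystal_inv //.
have [jm|jm] := ltnP j.-1 (size mu).
  by have /and3P[/eqP <- _ ?] := Bb _ jm; exact: size_count_iota.
by rewrite !nth_default ?sb // big1.
Qed.

Lemma tabloid_inv_Bmu T : Tabloids l mu T -> Bmu l mu (tabloid_inv (size mu) T).
Proof.
move=> [tT cT]; split=> [|j jm]; first by rewrite size_map size_iota.
have ael : all (fun a => 1 <= a <= l) (nth [::] (tabloid_inv (size mu) T) j).
  rewrite (nth_map 0) ?size_iota //; apply/allP => a /flatten_mapP[i].
  by rewrite mem_iota add1n ltnS => ? /nseqP[->].
apply/and3P; split=> //.
  rewrite -(size_count_iota ael) -(cT j.+1) // count_mem_flatten_tuple.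
  by apply/eqP; apply: eq_bigr => i _; rewrite count_tabloid_inv.
by rewrite (nth_map 0) ?size_iota // sorted_nseq_flatten.
Qed.

Lemma tabloid_invK T : Tabloids l mu T -> crystal_inv l (tabloid_inv (size mu) T) = T.
Proof.
move=> TT; have [/allP tT cT] := TT.
have [/allP tI _] := crystal_inv_Tabloids (tabloid_inv_Bmu TT).
apply: eq_from_tnth => i.
have /andP[sT pT] := tT _ (mem_tnth i T).
have /andP[sI pI] := tI _ (mem_tnth i (crystal_inv l (tabloid_inv (size mu) T))).
apply: sorted_count_eq => // -[|j].
  have count0 r : all (leq 1) r -> count_mem 0 r = 0.
    by move=> /allP r1; apply/count_memPn/negP => /r1.
  by rewrite !count0.
rewrite count_crystal_inv //=; have [jm|jm] := ltnP j (size mu).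
  by rewrite count_tabloid_inv.
rewrite nth_default ?size_map ?size_iota //=; apply/esym/eqP.
have := cT j.+1 isT; rewrite nth_default // count_mem_flatten_tuple => /eqP.
by rewrite sum_nat_eq0 => /forallP/(_ i).
Qed.

Lemma crystal_invK b : Bmu l mu b -> tabloid_inv (size mu) (crystal_inv l b) = b.
Proof.
move=> Bb; have [sb Bj] := Bb.
have [sI Ij] := tabloid_inv_Bmu (crystal_inv_Tabloids Bb).
apply: (@eq_from_nth _ [::]); first by rewrite sI.
rewrite sI => j jm; have /and3P[_ s1 a1] := Ij _ jm; have /and3P[_ s2 a2] := Bj _ jm.
apply: sorted_count_eq => // a; have [|al] := boolP (1 <= a <= l).
  case: a => // a /= al; rewrite (@count_tabloid_inv _ _ _ (Ordinal al)) //.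
  by rewrite count_crystal_inv.
have count0 v : all (fun a => 1 <= a <= l) v -> count_mem a v = 0.
  by move=> /allP va; apply/count_memPn; apply: contra al => /va.
by rewrite !count0.
Qed.

Lemma crystal_inv_bij : set_bij (Bmu l mu) (Tabloids l mu) (crystal_inv l).
Proof.
split=> [b|b b'|T TT]; first exact: crystal_inv_Tabloids.
  by rewrite !inE => Bb Bb' e; rewrite -(crystal_invK Bb) e crystal_invK.
exists (tabloid_inv (size mu) T); [exact: tabloid_inv_Bmu | exact: tabloid_invK].
Qed.

End InvBij.

(* Main.v *)
(* Record a tabloid, or the crystal element it corresponds to, by the numbers
   x_s(j) of letters j in the factor b^s, i.e. of entries s in row j. On these
   numbers both P_j and the crystal operator e_j^max become the same map
   [raise], so T is katabolizable iff a run of raisings sends it to an element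
   whose first factor is 1^mu_1 and whose remaining factors, rotated, are
   katabolizable; the DARK crystal is the set described by the same run, once
   runs are known not to depend on the chosen word and to be monotone in it.

   Monotonicity is proved for all affine words at once. Words are compared by
   their action on height functions of Maya diagrams (a 0-Hecke action). To a
   list of rows of size k one attaches weighted chains of interlacing height
   functions, and raising the list corresponds to moving such chains by one
   Hecke generator with optimal choices made site by site; this shows that the
   total amount raised by a run is monotone in the word. If the rows have size
   m + k, the combinatorial R-matrix splits them into rows of size m and rows of
   size k, and a run at level m + k is a run at level k followed by a run at
   level m along the letters kept by the first. Since mu is a partition, the
   levels increase from the last factor to the first and the two steps give the
   required stability by induction. *)

(* A step of the recursion freezes one factor and rotates the others, so the later words reach
   residue 0 and classical operators alone do not suffice. Freezing is modelled by a vacuum of level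
   m on the right of the list: past N rows of size m in the ground state 1^m, 2^m, ..., the letters
   i + N with i nonzero act on the remaining rows as i does on their rotation. For equal parts the
   whole recursion is thus one run along one affine word, and monotonicity in the word is enough.
   The obstacle is a change of part size. After splitting m + k into m and k, the rows of size k
   send unmatched letters into the rows of size m at each letter that is not kept, and the latter
   are then raised only partially. Hence stability must contain, besides monotonicity, the
   invisibility of such partial raisings. Comparisons of runs are reduced to numbers: a run is
   determined by the amounts raised, residue by residue, on every prefix of the list, and these
   amounts are maxima over sets of chains that grow with the word. *)
Require Import Defs.
From mathcomp Require Import all_boot all_order all_algebra.
From mathcomp Require Import generic_quotient.
From mathcomp Require Import boolp classical_sets functions zify ring.

Set Implicit Arguments.
Unset Strict Implicit.
Unset Printing Implicit Defensive.

Import Order.TTheory GRing.Theory Num.Theory.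

(** * Schensted insertion of two rows, in terms of multiplicities *)

Section Insertion.
Implicit Types (c d : nat -> nat) (R L r : seq nat) (x y s : nat).

(* [c s] and [d s] are the multiplicities of [s] in the upper and the lower row;
   [pending] counts the smaller letters of the upper row not yet used for bumping. *)
Fixpoint pending c d s : nat := if s is s'.+1 then c s' + (pending c d s' - d s') else 0.
Definition top_count c d s := c s + (d s - pending c d s).
Definition bottom_count c d s := minn (d s) (pending c d s).

(** The two [pending] counters agree except for [x < s <= y], where the one for [c] is ahead by the
    letter [x], still waiting for the letter [y] that it bumps. *)
Lemma top_count_bump c c' d d' x y : (forall s, c s = c' s + (s == x)) ->
  (forall s, s < x -> c' s = 0) -> x < y ->
  (forall s, d s + (s == x) = d' s + (s == y)) -> (forall s, x < s < y -> d s = 0) ->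
  forall s, top_count c d s = top_count c' d' s /\
      bottom_count c d s = bottom_count c' d' s + (s == y).
Proof.
move=> hc hx xy hd hy s.
have [h1 [h2 h3]] : (s <= x -> pending c d s = 0 /\ pending c' d' s = 0) /\
    (x < s <= y -> pending c d s = (pending c' d' s).+1) /\ (y < s ->
        pending c d s = pending c' d' s).
  elim: s => [|s [h1 [h2 h3]]] //=.
  have := hc s; have := hx s; have := hd s; have := hy s; lia.
rewrite /top_count /bottom_count; have := hc s; have := hx s; have := hd s; have := hy s; lia.
Qed.

Lemma top_count_append c c' d d' x : (forall s, c s = c' s + (s == x)) ->
  (forall s, s < x -> c' s = 0) ->
  (forall s, d' s = d s + (s == x)) -> (forall s, x < s -> d s = 0) ->
  forall s, top_count c d s = top_count c' d' s /\ bottom_count c d s = bottom_count c' d' s.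
Proof.
move=> hc hx hd hy s.
have [h1 h2] : (s <= x -> pending c d s = 0 /\ pending c' d' s = 0) /\
    (x < s -> pending c d s = (pending c' d' s).+1).
  elim: s => [|s [h1 h2]] //=.
  have := hc s; have := hx s; have := hd s; have := hy s; lia.
rewrite /top_count /bottom_count; have := hc s; have := hx s; have := hd s; have := hy s; lia.
Qed.

Variant row_insert_spec x r : option nat * seq nat -> Prop :=
| RowAppend of all (geq x) r : row_insert_spec x r (None, rcons r x)
| RowBump r1 y r2 of r = r1 ++ y :: r2 & all (geq x) r1 & x < y :
    row_insert_spec x r (Some y, r1 ++ x :: r2).

Lemma row_insertP x r : row_insert_spec x r (row_insert x r).
Proof.
elim: r => [|y r IH] /=; first exact: (@RowAppend x [::]).
case: ltnP => xy; first exact: (@RowBump x (y :: r) [::] y r).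
case: IH => [h|r1 y' r2 -> h xy'].
  by apply: (@RowAppend x (y :: r)); rewrite /= xy.
by apply: (@RowBump x _ (y :: r1) y' r2) => //=; rewrite xy.
Qed.

Lemma tableau_insert_row0 x Q :
  nth [::] (tableau_insert x Q) 0 = (row_insert x (nth [::] Q 0)).2.
Proof. by case: Q => //= R Q; case: (row_insert x R). Qed.

Lemma tableau_insert_row1 x Q : nth [::] (tableau_insert x Q) 1 =
  if (row_insert x (nth [::] Q 0)).1 is Some y then (row_insert y (nth [::] Q 1)).2
  else nth [::] Q 1.
Proof.
case: Q => //= R Q; case: (row_insert x R) => -[y|] r' //=.
exact: tableau_insert_row0.
Qed.

Lemma sorted_catP r1 r2 : sorted leq (r1 ++ r2) =
  [&& sorted leq r1, sorted leq r2 & all (fun a => all (leq a) r2) r1].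
Proof.
by rewrite !(sorted_pairwise leq_trans) pairwise_cat andbC -andbA; congr andb.
Qed.

Lemma count_mem_sorted r s x : sorted leq (x :: r) -> s < x -> count_mem s r = 0.
Proof.
rewrite /= (path_sortedE leq_trans) => /andP[/allP h _] sx.
by apply/count_memPn/negP => /h; rewrite leqNgt sx.
Qed.

Local Notation cm r := (fun s => count_mem s r).

(** The last hypothesis makes every bumped letter land at the end of the lower row. It survives each
    insertion because the letters of [r] come in weakly increasing order. *)
Lemma insert_words r Q : let R := nth [::] Q 0 in let L := nth [::] Q 1 in
  sorted leq R -> sorted leq L -> sorted leq r ->
  (forall x y z, x \in r -> y \in R -> z \in L -> x < y -> z <= y) ->
  let Q' := foldl (fun t x => tableau_insert x t) Q r in
  [/\ sorted leq (nth [::] Q' 0), sorted leq (nth [::] Q' 1) & forall s,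
    count_mem s (nth [::] Q' 0) = top_count (cm r) (cm R) s /\
    count_mem s (nth [::] Q' 1) = count_mem s L + bottom_count (cm r) (cm R) s].
Proof.
elim: r Q => [|x r IH] Q R L sR sL sr inv /=.
  split=> // s.
  have p0 : pending (fun=> 0) (cm R) s = 0 by elim: s => //= s ->.
  by rewrite /top_count /bottom_count p0 minn0 addn0 subn0.
have sr' : sorted leq r by exact: path_sorted sr.
have xr z : z \in r -> x <= z.
  by move: sr; rewrite /= (path_sortedE leq_trans) => /andP[/allP h _] /h.
have hx s : s < x -> count_mem s r = 0 by exact: count_mem_sorted sr.
have hc s : (x == s) + count_mem s r = count_mem s r + (s == x) by rewrite addnC eq_sym.
have := IH (tableau_insert x Q); rewrite /= tableau_insert_row0 tableau_insert_row1 -/R -/L.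
case: (row_insertP x R) => [hR|R1 y R2 eR hR1 xy] /=.
  case=> //.
  - rewrite -cats1 sorted_catP sR /=; apply/allP => a /(allP hR); rewrite /= andbT.
    by [].
  - move=> x' y z x'r; rewrite mem_rcons inE => /orP[/eqP -> _|yR zL].
      by move=> lt; have := xr _ x'r; lia.
    by apply: inv => //; rewrite inE x'r orbT.
  move=> h1 h2 h3; split=> // s; have [-> ->] := h3 s.
  have hd a : count_mem a (rcons R x) = count_mem a R + (a == x).
    by rewrite -cats1 count_cat /= addn0 eq_sym.
  have hy a : x < a -> count_mem a R = 0.
    by move=> xa; apply/count_memPn/negP => /(allP hR) /=; rewrite leqNgt xa.
  by have [-> ->] := top_count_append hc hx hd hy s.
have yR : y \in R by rewrite eR mem_cat mem_head orbT.
have hL : all (geq y) L.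
  by apply/allP => z zL /=; apply: (inv x) => //; rewrite mem_head.
have := sR; rewrite eR sorted_catP => /and3P[sR1 sR2 h12].
have yR2 a : a \in R2 -> y <= a.
  by move: sR2; rewrite /= (path_sortedE leq_trans) => /andP[/allP h _] /h.
have -> : (row_insert y L).2 = rcons L y.
  case: (row_insertP y L) => // L1 y' L2 eL _ yy'.
  by move: hL; rewrite eL all_cat /= [y' <= y]leqNgt yy' andbF.
case=> //.
- rewrite sorted_catP sR1 /=; apply/andP; split.
    rewrite (path_sortedE leq_trans); apply/andP; split; last exact: path_sorted sR2.
    by apply/allP => a /yR2 ya; apply: leq_trans ya; exact: ltnW.
  apply/allP => a aR1 /=; have ax : a <= x by exact: (allP hR1 _ aR1).
  rewrite ax /=.
  apply/allP => b bR2; apply: leq_trans ax _; apply: leq_trans (yR2 _ bR2).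
  exact: ltnW.
- by rewrite -cats1 sorted_catP sL /=; apply/allP => a /(allP hL) /=; rewrite andbT.
- move=> x' y' z x'r; have xx' := xr _ x'r.
  rewrite mem_cat inE mem_rcons inE => y'R zL lt.
  have y'R2 : y' \in R2.
    have xy' := leq_ltn_trans xx' lt.
    case/or3P: y'R => // [/(allP hR1) /=|/eqP e]; first by rewrite leqNgt xy'.
    by rewrite e ltnn in xy'.
  case/orP: zL => [/eqP ->|zL]; first exact: yR2.
  apply: (inv x') => //; first by rewrite inE x'r orbT.
  by rewrite eR mem_cat inE y'R2 !orbT.
move=> h1 h2 h3; split=> // s; have [-> ->] := h3 s.
have hd a : count_mem a R + (a == x) = count_mem a (R1 ++ x :: R2) + (a == y).
  by rewrite eR !count_cat /= ![_ == a]eq_sym; clear; lia.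
have hy a : x < a < y -> count_mem a R = 0.
  move=> /andP[xa ay]; rewrite eR count_cat /=.
  rewrite (_ : count_mem a R1 = 0); last first.
    by apply/count_memPn/negP => /(allP hR1) /=; rewrite leqNgt xa.
  rewrite (_ : count_mem a R2 = 0); last first.
    by apply/count_memPn/negP => /yR2; rewrite leqNgt ay.
  by rewrite eq_sym (ltn_eqF ay).
have [e1 e2] := top_count_bump hc hx xy hd hy s.
rewrite -eR; split; first exact: esym e1.
apply: etrans (congr1 (addn (count_mem s L)) (esym e2)).
by rewrite -cats1 count_cat /= addn0 [y == s]eq_sym -addnA [_ + bottom_count _ _ _]addnC.
Qed.

Lemma insertion_tableauP r2 r1 : sorted leq r2 -> sorted leq r1 ->
  let Q := insertion_tableau (r2 ++ r1) in
  [/\ sorted leq (nth [::] Q 0), sorted leq (nth [::] Q 1) & forall s,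
    count_mem s (nth [::] Q 0) = top_count (cm r1) (cm r2) s /\
    count_mem s (nth [::] Q 1) = bottom_count (cm r1) (cm r2) s].
Proof.
move=> s2 s1 Q; rewrite {}/Q /insertion_tableau foldl_cat.
have [|||//|q0 q1 qc] := @insert_words r2 [::] => //.
set Q := foldl _ [::] r2 in q0 q1 qc *.
have e0 : nth [::] Q 0 = r2.
  apply: sorted_count_eq => // s; have [-> _] := qc s.
  by rewrite /top_count /= sub0n addn0.
have e1 : nth [::] Q 1 = [::].
  apply: sorted_count_eq => // s; have [_ ->] := qc s.
  by rewrite /bottom_count /= min0n.
have [||||h0 h1 h2] := @insert_words r1 Q; rewrite ?e0 ?e1 //.
split=> // s; have [-> ->] := h2 s; by rewrite e0 e1.
Qed.

End Insertion.

Lemma count_kat_row s (r : seq nat) :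
  count_mem s [seq a.-1 | a <- r & a != 1] = count_mem (if s == 0 then 0 else s.+1) r.
Proof.
rewrite count_map count_filter; apply: eq_count => -[|[|a]] /=; case: s => //= s.
by rewrite andbT eqSS.
Qed.

Lemma kat_row l (T : tabloid l) (i : 'I_l) :
  tnth (kat T) i = [seq a.-1 | a <- tnth T (ordS i) & a != 1].
Proof. by rewrite tnth_mktuple (nth_tabloid T (ordS i)). Qed.

Lemma kat_Tabloids l m mu (T : tabloid l) :
  Tabloids l (m :: mu) T -> Tabloids l mu (kat T).
Proof.
move=> [/allP tT cT]; split.
  apply/allP => r /tnthP[i ->]; rewrite kat_row.
  have /andP[sr /allP pr] := tT _ (mem_tnth (ordS i) T); apply/andP; split.
    apply: (@homo_sorted _ _ predn leq leq); first by move=> x y; lia.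
    exact: (sorted_filter leq_trans).
  apply/allP => a' /mapP[a]; rewrite mem_filter => /andP[a1 /pr a0] ->.
  by case: a a1 a0 => [|[]].
move=> s s0; have := cT s.+1 isT; case: s s0 => // s _ /= <-.
rewrite (@count_mem_flatten_tuple l (kat T)) (@count_mem_flatten_tuple l T) [RHS](reindex
    (@ordS l)); last exact: onW_bij (@ordS_bij l).
by apply: eq_bigr => i _; rewrite kat_row count_kat_row.
Qed.

Local Open Scope ring_scope.

(** * Height functions and the order on affine words *)

Section Heights.
Variable l' : nat.
Local Notation Res := 'I_l'.+2.
Implicit Types (i j : Res) (b : int) (c : int -> int) (v u y w : seq Res).

Definition res b : Res := b%:~R.

Lemma resS b : res (b + 1) = res b + 1.
Proof. by rewrite /res intrD. Qed.

Lemma resP b : res (b - 1) = res b - 1.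
Proof. by rewrite /res intrB. Qed.

Lemma succ_neq i : (i + 1 == i) = false.
Proof. by rewrite -subr_eq0 addrAC subrr add0r oner_eq0. Qed.

Lemma site_next i b : res b = i -> (res (b + 1) == i) = false.
Proof. by move=> <-; rewrite resS succ_neq. Qed.

Lemma site_prev i b : res b = i -> (res (b - 1) == i) = false.
Proof. by move=> <-; rewrite resP eq_sym -{1}[res b](subrK 1) succ_neq. Qed.

(** Heights count the beads of a Maya diagram from a site on. A site of residue [i + 1] gets the
    largest height that the Maya inequalities with its two neighbours allow. *)
Definition act i c b : int :=
  if res b == i + 1 then Num.min (c (b - 1)) (c (b + 1) + 1) else c b.
Definition acts v c := foldr act c v.
(** The diagram in which exactly the sites below [a] are occupied. *)
Definition vac_height (a b : int) : int := Num.max 0 (a - b).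
Definition Maya c := forall b, c (b + 1) <= c b <= c (b + 1) + 1.
Definition height_le v v' := forall a b, acts v (vac_height a) b <= acts v' (vac_height a) b.

Lemma MayaP c b : Maya c -> c b <= c (b - 1) <= c b + 1.
Proof. by move=> /(_ (b - 1)); rewrite subrK. Qed.

Lemma Maya_vac_height a : Maya (vac_height a).
Proof. by move=> b; rewrite /vac_height; lia. Qed.

Lemma act_mono i c c' : (forall b, c b <= c' b) -> forall b, act i c b <= act i c' b.
Proof.
move=> h b; rewrite /act; case: ifP => // _.
by have := h (b - 1); have := h (b + 1); lia.
Qed.

Lemma acts_mono v c c' : (forall b, c b <= c' b) -> forall b, acts v c b <= acts v c' b.
Proof. by move=> h; elim: v => //= i v IH; exact: act_mono. Qed.

Lemma act_Maya i c : Maya c -> Maya (act i c).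
Proof.
move=> mc b; rewrite /act addrK.
have := mc b; have := mc (b + 1); have := MayaP b mc.
have [e|_] := eqVneq (res b) (i + 1).
  by rewrite (site_next e); lia.
by case: ifP => _; lia.
Qed.

Lemma acts_Maya v c : Maya c -> Maya (acts v c).
Proof. by move=> mc; elim: v => //= i v; exact: act_Maya. Qed.

Lemma act_infl i c b : Maya c -> c b <= act i c b.
Proof.
by move=> mc; rewrite /act; case: ifP => // _; have := mc b; have := MayaP b mc; lia.
Qed.

Lemma acts_infl v c b : Maya c -> c b <= acts v c b.
Proof.
move=> mc; elim: v => //= i v IH; apply: le_trans IH _.
by apply: act_infl; exact: acts_Maya.
Qed.

Lemma act_add i c k b : act i (fun b => c b + k) b = act i c b + k.
Proof. by rewrite /act; case: ifP => // _; lia. Qed.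

Lemma acts_cat u v c : acts (u ++ v) c = acts u (acts v c).
Proof. by rewrite /acts foldr_cat. Qed.

Lemma acts_add v c k b : acts v (fun b => c b + k) b = acts v c b + k.
Proof.
elim: v b => //= i v IH b; rewrite -act_add; congr (act i _ b).
exact/funext.
Qed.

Lemma Maya_dist c b (n : nat) : Maya c -> c (b + n%:Z) <= c b <= c (b + n%:Z) + n%:Z.
Proof.
move=> mc; elim: n => [|n IH]; first by rewrite addr0; lia.
by have := mc (b + n%:Z); rewrite (_ : b + n.+1%:Z = b + n%:Z + 1); lia.
Qed.

Lemma Maya_le_vac_height c a b : Maya c -> c b <= vac_height a b + c a.
Proof.
move=> mc; rewrite /vac_height; case: (lerP a b) => ab.
  by have := @Maya_dist c a `|b - a|%N mc; rewrite (_ : a + _ = b); lia.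
by have := @Maya_dist c b `|a - b|%N mc; rewrite (_ : b + _ = a); lia.
Qed.

(* On Maya functions [acts y] is min-plus linear, so it is determined by its
   values on the vacua. *)
Lemma acts_le_vac_height y c a b : Maya c -> acts y c b <= acts y (vac_height a) b + c a.
Proof.
move=> mc; rewrite -acts_add; apply: acts_mono => {}b.
exact: Maya_le_vac_height.
Qed.

Lemma acts_vac_height_attained y c b :
  exists a, acts y (vac_height a) b + c a <= acts y c b.
Proof.
elim: y b => [|i y IH] b; first by exists b; rewrite /= /vac_height; lia.
rewrite /= {2}/act; case: ifP => e; last first.
  by have [a ha] := IH b; exists a; rewrite /act e.
have [a1 h1] := IH (b - 1); have [a2 h2] := IH (b + 1).
case: (lerP (acts y c (b - 1)) (acts y c (b + 1) + 1)) => h.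
  by exists a1; rewrite /act e; lia.
by exists a2; rewrite /act e; lia.
Qed.

(** Testing on vacua suffices: the vacuum that attains the value for [y'] bounds the value for
    [y]. *)
Lemma height_le_Maya y y' c b : height_le y y' -> Maya c -> acts y c b <= acts y' c b.
Proof.
move=> yy mc; have [a ha] := acts_vac_height_attained y' c b.
by have := acts_le_vac_height y a b mc; have := yy a b; lia.
Qed.

Lemma height_le_refl v : height_le v v. Proof. by move=> a b. Qed.

Lemma height_le_trans v u w : height_le v u -> height_le u w -> height_le v w.
Proof. by move=> vu uw a b; exact: le_trans (vu a b) (uw a b). Qed.

Lemma height_le_cat v v' u u' : height_le v v' -> height_le u u' ->
    height_le (v ++ u) (v' ++ u').
Proof.
move=> vv uu a b; rewrite !acts_cat;
    apply: (@le_trans _ _ (acts v (acts u' (vac_height a)) b)).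
  exact: acts_mono.
by apply: height_le_Maya => //; apply: acts_Maya; exact: Maya_vac_height.
Qed.

Lemma height_le_catr u v v' : height_le v v' -> height_le (v ++ u) (v' ++ u).
Proof. by move=> h; apply: height_le_cat => //; exact: height_le_refl. Qed.

Lemma height_le_nil v : height_le [::] v.
Proof. by move=> a b; apply: acts_infl; exact: Maya_vac_height. Qed.

Lemma height_le_consr i v : height_le v (i :: v).
Proof. exact: (@height_le_catr v [::] [:: i] (height_le_nil _)). Qed.

Lemma height_le_suffix u v : height_le v (u ++ v).
Proof. exact: (@height_le_catr v [::] u (height_le_nil _)). Qed.

Lemma act_idem i c : act i (act i c) = act i c.
Proof.
apply/funext => b; rewrite {1}/act; case: eqP => // e.
by rewrite /act (site_next e) (site_prev e) e eqxx.
Qed.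

Lemma act_comm i j c : j != i + 1 -> i != j + 1 -> act i (act j c) = act j (act i c).
Proof.
move=> ij ji; apply/funext => b; rewrite /act.
have e1 k : (res (b - 1) == k + 1) = (res b == k + 1 + 1).
  by rewrite resP subr_eq.
have e2 k : (res (b + 1) == k + 1) = (res b == k).
  by rewrite resS (inj_eq (addIr 1)).
rewrite !e1 !e2.
have [ei|ni] := eqVneq (res b) (i + 1); have [ej|nj] := eqVneq (res b) (j + 1) => //.
- by have -> : i = j by apply: (addIr 1); rewrite -ei.
- rewrite ei (inj_eq (addIr 1)) (negbTE ji) eq_sym (negbTE ij) //.
- by rewrite ej (inj_eq (addIr 1)) (negbTE ij) eq_sym (negbTE ji).
Qed.

(** The condition [i != j + 1] excludes the case of two residues, where [i + 2 = i]. *)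
Lemma act_braid i j c : Maya c -> j = i + 1 -> i != j + 1 ->
  act i (act j (act i c)) = act j (act i (act j c)).
Proof.
move=> mc -> ij; apply/funext => b.
have h : (i + 1 == i + 1 + 1) = false by rewrite eq_sym succ_neq.
have h3 : (i + 1 + 1 + 1 == i + 1) = false.
  by rewrite (inj_eq (addIr 1)) eq_sym (negbTE ij).
have h4 : (i + 1 + 1 == i + 1) = false by rewrite succ_neq.
have h5 : (i == i + 1 + 1) = false by exact/negbTE.
have h6 : (i == i + 1) = false by rewrite eq_sym succ_neq.
have h7 : (i + 1 + 1 + 1 == i + 1 + 1) = false by rewrite succ_neq.
rewrite /act !resP !resS.
have [ei|ni] := eqVneq (res b) (i + 1).
  rewrite !(ei, resP, addrK, subrK, h, h3, h4, h5, h6, h7, eqxx).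
  by have := mc b; have := mc (b + 1); have := MayaP b mc; lia.
have [ej|nj] := eqVneq (res b) (i + 1 + 1) => //.
  rewrite !(ej, resP, addrK, subrK, h, h3, h4, h5, h6, h7, eqxx).
  have := mc b; have := MayaP b mc; have := MayaP (b - 1) mc.
  by lia.
Qed.
End Heights.

(** * Finitely supported sums over the integers *)

Section FiniteSums.
Implicit Types (f g : int -> int) (M : nat).

Definition supported M f := forall n : int, (n < - M%:Z) || (M%:Z <= n) -> f n = 0.
Definition finsupp f := exists M, supported M f.
Definition window_sum M f : int := \sum_(0 <= k < M.*2) f (k%:Z - M%:Z).

Lemma supportedW M M' f : (M <= M')%N -> supported M f -> supported M' f.
Proof. by move=> h bf n hn; apply: bf; lia. Qed.

Lemma window_sumS M f : supported M f -> window_sum M.+1 f = window_sum M f.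
Proof.
move=> bf; rewrite /window_sum doubleS big_nat_recl // big_nat_recr //=.
rewrite bf ?add0r; last by lia.
rewrite [f (_ - _)]bf ?addr0; last by lia.
by apply: eq_bigr => k _; congr f; lia.
Qed.

Lemma window_sumW M M' f : (M <= M')%N -> supported M f -> window_sum M' f = window_sum M f.
Proof.
move=> h bf; rewrite -(subnKC h); elim: (M' - M)%N => [|n IH]; first by rewrite addn0.
by rewrite addnS window_sumS //; apply: supportedW bf; lia.
Qed.

(** Total, with default 0 off finite support; by [SumE] the chosen window is irrelevant, so sums
    with different supports can be compared. *)
Definition Sum f : int :=
  if pselect (finsupp f) is left h then window_sum (sval (cid h)) f else 0.

Lemma SumE M f : supported M f -> Sum f = window_sum M f.
Proof.
move=> bf; rewrite /Sum; case: pselect => [h|[]]; last by exists M.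
case: cid => M' bf' /=; case: (leqP M M') => h'; first exact: window_sumW.
by rewrite -(window_sumW (ltnW h')).
Qed.

Lemma finsupp_supp f g : finsupp f -> (forall n, f n = 0 -> g n = 0) -> finsupp g.
Proof. by move=> [M bf] fg; exists M => n hn; apply: fg; exact: bf. Qed.

Lemma finsuppD f g : finsupp f -> finsupp g -> finsupp (fun n => f n + g n).
Proof.
move=> [M bf] [M' bg]; exists (M + M')%N => n hn.
by rewrite bf ?bg ?addr0 //; lia.
Qed.

Lemma finsuppM (k : int -> int) f : finsupp f -> finsupp (fun n => k n * f n).
Proof. by move=> lower; apply: finsupp_supp lower _ => n ->; rewrite mulr0. Qed.

Lemma finsuppN f : finsupp f -> finsupp (fun n => - f n).
Proof. by move=> lower; apply: finsupp_supp lower _ => n ->; rewrite oppr0. Qed.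

Lemma finsuppB f g : finsupp f -> finsupp g -> finsupp (fun n => f n - g n).
Proof. by move=> lower /finsuppN; exact: finsuppD. Qed.

Lemma finsupp_shift f k : finsupp f -> finsupp (fun n => f (n + k)).
Proof. by move=> [M bf]; exists (M + `|k|)%N => n hn; apply: bf; lia. Qed.

Lemma finsupp_delta a k : finsupp (fun n => if n == a then k else 0).
Proof. by exists `|a|.+1 => n hn; case: eqP => // ?; lia. Qed.

Lemma SumD f g : finsupp f -> finsupp g -> Sum (fun n => f n + g n) = Sum f + Sum g.
Proof.
move=> [M bf] [M' bg].
have bf' : supported (M + M') f by apply: supportedW bf; lia.
have bg' : supported (M + M') g by apply: supportedW bg; lia.
rewrite (SumE bf') (SumE bg') (@SumE (M + M')) => [|n hn].
  by rewrite /window_sum -big_split.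
by rewrite bf' ?bg'.
Qed.

Lemma SumZ k f : finsupp f -> Sum (fun n => k * f n) = k * Sum f.
Proof.
move=> [M bf]; rewrite (SumE bf) (@SumE M) => [|n hn]; last by rewrite bf ?mulr0.
by rewrite /window_sum mulr_sumr.
Qed.

Lemma SumN f : finsupp f -> Sum (fun n => - f n) = - Sum f.
Proof.
move=> lower; rewrite -mulN1r -SumZ //; congr Sum; apply/funext => n.
by rewrite mulN1r.
Qed.

Lemma SumB f g : finsupp f -> finsupp g -> Sum (fun n => f n - g n) = Sum f - Sum g.
Proof. by move=> lower fg; rewrite -SumN // -SumD //; exact: finsuppN. Qed.

Lemma Sum_shift f : finsupp f -> Sum (fun n => f (n + 1)) = Sum f.
Proof.
move=> [M bf]; rewrite (SumE bf) (@SumE M.+1) => [|n hn]; last by apply: bf; lia.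
rewrite /window_sum doubleS !big_nat_recr //=.
rewrite [f (_ - _ + _)]bf ?addr0; last by lia.
rewrite [f (_ - _ + _)]bf ?addr0; last by lia.
by apply: eq_bigr => k _; congr f; lia.
Qed.

Lemma Sum_ge0 f : (forall n, 0 <= f n) -> 0 <= Sum f.
Proof.
move=> f0; rewrite /Sum; case: pselect => // h; apply: sumr_ge0 => k _; exact: f0.
Qed.

Lemma Sum_le f g : finsupp f -> finsupp g -> (forall n, f n <= g n) -> Sum f <= Sum g.
Proof.
move=> lower fg fg'; rewrite -subr_ge0 -SumB //; apply: Sum_ge0 => n.
by rewrite subr_ge0.
Qed.

Lemma Sum_eq0 f : finsupp f -> (forall n, 0 <= f n) -> Sum f = 0 -> forall n, f n = 0.
Proof.
move=> [M bf] f0; rewrite (SumE bf) /window_sum big_mkord => /eqP.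
rewrite psumr_eq0 // => /allP h n.
case: (boolP ((n < - M%:Z) || (M%:Z <= n))) => [/bf//|hn].
have lt : (absz (n + M%:Z)%R < M.*2)%N by lia.
have := h (Ordinal lt); rewrite mem_index_enum => /(_ isT) /=.
by rewrite (_ : _ - _ = n); [move/eqP|lia].
Qed.

Lemma Sum_zero : Sum (fun=> 0) = 0.
Proof. by rewrite (@SumE 0) // /window_sum big_geq. Qed.

Lemma Sum_delta a k : Sum (fun n => if n == a then k else 0) = k.
Proof.
pose M := `|a|.+1.
have bf : supported M (fun n => if n == a then k else 0).
  by move=> n hn; case: eqP => // ?; lia.
have lt : (absz (a + M%:Z)%R < M.*2)%N by rewrite /M; lia.
rewrite (SumE bf) /window_sum big_mkord (bigD1 (Ordinal lt)) //= ifT; last by apply/eqP; lia.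
rewrite big1 ?addr0 // => j /eqP jn; case: eqP => // e; case: jn.
by apply/val_inj => /=; lia.
Qed.

End FiniteSums.

(** * Raising lists of rows, and chains of height functions *)

Section Rows.
Variable l' : nat.
Local Notation Res := 'I_l'.+2.
Definition row := Res -> nat.
Implicit Types (i j : Res) (x : row) (z : seq row).

(* [a] is the number of unmatched letters [i] standing to the right of the row;
   they protect as many letters [i + 1] from being changed into [i], and
   [row_phi] is the number of unmatched letters passed on to the left. Lists of
   rows have the rightmost tensor factor at their head. *)
Definition row_raise i (a : nat) x : row := fun j =>
  if j == i then (x i + (x (i + 1)%R - a))%N
  else if j == (i + 1)%R then minn (x (i + 1)%R) a else x j.
Definition row_phi i (a : nat) x : nat := (x i + (a - x (i + 1)%R))%N.

Fixpoint raise i a z : seq row :=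
  if z is x :: t then row_raise i a x :: raise i (row_phi i a x) t else [::].
Fixpoint list_phi i a z : nat := if z is x :: t then list_phi i (row_phi i a x) t else a.
Fixpoint list_raised i a z : nat :=
  if z is x :: t then (x (i + 1)%R - a + list_raised i (row_phi i a x) t)%N else 0.

Lemma raise_cat i a z t :
  raise i a (z ++ t) = raise i a z ++ raise i (list_phi i a z) t.
Proof. by elim: z a => //= x z IH a; rewrite IH. Qed.

Lemma list_phi_cat i a z t : list_phi i a (z ++ t) = list_phi i (list_phi i a z) t.
Proof. by elim: z a => //= x z IH a. Qed.

Lemma size_raise i a z : size (raise i a z) = size z.
Proof. by elim: z a => //= x z IH a; rewrite IH. Qed.

Section Weights.
Variable kap : int.
Local Notation K := (vac_height kap).
Implicit Types (c d : int -> int).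

Definition charged c := [/\ Maya c, (forall b, K b <= c b) & finsupp (fun b => c b - K b)].
Definition interlaced c c' := forall b,
  (c' b <= c b <= c' b + 1) && (c' (b + 1) <= c b <= c' (b + 1) + 1).
(* The weight is counted relative to the vacuum, which has infinite support. *)
Definition row_wt x c c' : int :=
  Sum (fun n => (x (res l' n))%:Z * (c n - K n) - (x (res l' n - 1))%:Z * (c' n - K n)).
(** [c] sits at the head of the list, where the vacuum enters, and [c'] at the far end, where
    unmatched letters leave. *)
Fixpoint chain z c c' (w : int) : Prop :=
  if z is x :: t then
    exists c1 w1, [/\ charged c1, interlaced c c1, chain t c1 c' w1 & w = row_wt x c c1 + w1]
  else c = c' /\ w = 0.
(** These are the moves below [act i], with the choice at each site left open; [act i] itself is the
    largest one. *)
Definition up_move i c c' (n : int) :=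
  [/\ charged c', (forall b, c b <= c' b <= c b + 1),
      (forall b, res l' b != i + 1 -> c' b = c b) & n = Sum (fun b => c' b - c b)].

Definition at_charge i (n : nat) : int := if res l' kap == i + 1 then n%:Z else 0.

Lemma finsupp_charged c c' : charged c -> charged c' -> finsupp (fun b => c b - c' b).
Proof.
move=> [_ _ fc] [_ _ fc']; apply: finsupp_supp (finsuppB fc fc') _ => n; lia.
Qed.

Local Notation I i b := (if res l' b == i + 1 then 1 else 0 : int).

(** The weight is linear in the row, and [x (i + 1) - a] letters change from [i + 1] to [i]; this
    brings in a second difference of heights at the sites of residue [i + 1]. The vacuum has second
    difference 1 at [kap] and 0 elsewhere, whence [at_charge]. *)
Lemma row_wt_raise i a x c c' : charged c -> charged c' ->
  row_wt (row_raise i a x) c c' = row_wt x c c' + (x (i + 1)%R - a)%N%:Z *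
    (Sum (fun b => I i b * (c (b - 1) - c b - c' b + c' (b + 1))) - at_charge i 1).
Proof.
move=> [_ _ fc] [_ _ fc'].
set d := fun b => c b - K b; set d' := fun b => c' b - K b.
have K2 : Sum (fun b => I i b * (if b == kap then 1 else 0)) = at_charge i 1.
  have -> : (fun b => I i b * (if b == kap then 1 else 0)) =
            (fun b => if b == kap then at_charge i 1 else 0).
    by apply/funext => b; rewrite /at_charge; have [->|_] := eqVneq b kap; case: ifP.
  exact: Sum_delta.
have fsec : finsupp (fun b => c (b - 1) - c b - c' b + c' (b + 1)).
  have := finsuppD (finsuppB (finsuppB (finsupp_shift (-1) fc) fc) fc') (finsupp_shift 1 fc').
  move/finsuppD => /(_ _ (finsupp_delta kap 1)) lower; apply: finsupp_supp lower _ => n.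
  by rewrite /vac_height; case: eqP; lia.
rewrite -K2 -SumB; [|exact: finsuppM|by apply: finsuppM; exact: finsupp_delta].
have -> : (fun n => I i n * (c (n - 1) - c n - c' n + c' (n + 1)) -
   I i n * (if n == kap then 1 else 0)) =
   fun n => I i n * (d (n - 1) - d n - d' n + d' (n + 1)).
  apply/funext => n; rewrite -mulrBr; congr (_ * _).
  by rewrite /d /d' /vac_height; case: eqP; lia.
have fd1 : finsupp (fun n => I i n * d (n - 1)) by apply/finsuppM/finsupp_shift.
have fd2 : finsupp (fun n => I i n * d n) by apply/finsuppM.
have fd3 : finsupp (fun n => I i n * d' n) by apply/finsuppM.
have fd4 : finsupp (fun n => I i n * d' (n + 1)) by apply/finsuppM/finsupp_shift.
have -> : (fun n => I i n * (d (n - 1) - d n - d' n + d' (n + 1))) =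
   fun n => I i n * d (n - 1) - I i n * d n - I i n * d' n + I i n * d' (n + 1).
  by apply/funext => n; rewrite !(mulrDr, mulrN).
rewrite SumD //; last by do 2?apply: finsuppB.
rewrite SumB //; last exact: finsuppB.
rewrite SumB // -(Sum_shift fd1).
have fg : finsupp (fun n => I i (n - 1) * d' n).
  by apply: finsupp_supp fc' _ => n e; rewrite /d' e mulr0.
have -> : Sum (fun n => I i n * d' (n + 1)) = Sum (fun n => I i (n - 1) * d' n).
  rewrite -(Sum_shift fg); congr Sum; apply/funext => n; by rewrite addrK.
set e : int := (x (i + 1)%R - a)%N%:Z.
have fg1 : finsupp (fun n => I i (n + 1) * d (n + 1 - 1)) by apply: finsupp_shift fd1.
rewrite /row_wt -SumB // -SumB //; last exact: finsuppB.
rewrite -SumD //; last by do 2?apply: finsuppB.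
have fw y : finsupp (fun n => (y n : int) * d n) by apply: finsuppM.
have fw' y : finsupp (fun n => (y n : int) * d' n) by apply: finsuppM.
have fb : finsupp (fun n => (x (res l' n))%:Z * (c n - K n) - (x (res l' n - 1))%:Z * (c' n
    - K n)).
  by apply: finsuppB; apply: finsuppM.
rewrite -SumZ; last by apply: finsuppD => //; apply: finsuppB => //; apply: finsuppB.
rewrite -SumD //; last first.
  by apply: finsuppM; apply: finsuppD => //; apply: finsuppB => //; apply: finsuppB.
congr Sum; apply/funext => n; rewrite addrK -/(d n) -/(d' n).
rewrite resS resP /e /row_raise !(inj_eq (addIr 1)).
have -> : (res l' n - 1 == i) = (res l' n == i + 1) by rewrite subr_eq.
have minz u v : (minn u v)%:Z = u%:Z - (u - v)%N%:Z by lia.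
have [e1|n1] := eqVneq (res l' n) i.
  rewrite e1 eq_sym succ_neq PoszD.
  (* With only two residues, [i - 1] and [i + 1] coincide. *)
  have [e2|n2] := eqVneq (i - 1) (i + 1); last by ring.
  by rewrite e2 minz; ring.
have [e2|n2] := eqVneq (res l' n) (i + 1).
  by rewrite e2 addrK eq_sym succ_neq PoszD minz; ring.
have [e3|n3] := eqVneq (res l' n - 1) (i + 1); last by ring.
by rewrite e3 minz; ring.
Qed.

Lemma row_wt_up_move i x c cp n c' c'' n' : charged c -> charged c' -> up_move i c cp n ->
    up_move i c' c'' n' ->
  row_wt x cp c'' = row_wt x c c' + (x (i + 1))%:Z * n - (x i)%:Z * n'.
Proof.
move=> oc oc' [ocp _ s ->] [oc'' _ s' ->].
have f1 := finsupp_charged ocp oc; have f2 := finsupp_charged oc'' oc'.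
have [_ _ fc] := oc; have [_ _ fc'] := oc'.
have fb : finsupp (fun n => (x (res l' n))%:Z * (c n - K n) - (x (res l' n - 1))%:Z * (c' n
    - K n)).
  by apply: finsuppB; apply: finsuppM.
rewrite -!SumZ // /row_wt -SumD //; last exact: finsuppM.
rewrite -SumB; [|by apply: finsuppD => //; apply: finsuppM|exact: finsuppM].
congr Sum; apply/funext => b.
have [e|nb] := eqVneq (res l' b) (i + 1); last by rewrite s // s' //; nia.
by rewrite e addrK; nia.
Qed.

(* On the sites of residue [i + 1] the moved height function may be chosen
   independently: the smallest choice is optimal if the row is protected
   ([x (i + 1) <= a]), the largest one otherwise. *)
Lemma row_raise_lift i a x c c' c'' n' : charged c -> charged c' -> interlaced c c' ->
    up_move i c' c'' n' ->
  exists cp n, [/\ up_move i c cp n, interlaced cp c'' &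
    row_wt (row_raise i a x) c c' - (row_phi i a x)%:Z * n' <=
    row_wt x cp c'' - a%:Z * n - at_charge i (x (i + 1)%R - a)%N].
Proof.
move=> oc oc' ad up; have [oc'' h' s' en'] := up.
have [mc Kc [M bc]] := oc; have [mc' Kc' [M' bc']] := oc'; have [mc'' Kc'' [M'' bc'']] := oc''.
pose cp b := if res l' b == i + 1 then
    if (x (i + 1)%R <= a)%N then Num.max (c b) (c'' b)
    else Num.min (c (b - 1)) (c'' (b + 1) + 1)
  else c b.
have hsite b : res l' b = i + 1 -> c'' (b - 1) = c' (b - 1) /\ c'' (b + 1) = c' (b + 1).
  by move=> e; rewrite !s' ?(site_prev e) ?(site_next e).
(* Outside this window the vacuum is affine around [b], so both formulas for [cp] return the vacuum
   height. *)
have bcp : supported (M + M' + M'' + `|kap|.+2) (fun b => cp b - K b).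
  move=> b hb; rewrite /cp.
  have := bc b; have := bc'' b; have := bc (b - 1); have := bc'' (b + 1).
  rewrite /vac_height => h1 h2 h3 h4.
  do 2?case: ifP => _; lia.
have upcp : up_move i c cp (Sum (fun b => cp b - c b)).
  split => //; last first.
  - by move=> b /negbTE e; rewrite /cp e.
  - move=> b; rewrite /cp; case: eqP => [e|_]; last by lia.
    have [e1 e2] := hsite _ e.
    have := ad b; have := h' b; have := mc b; have := MayaP b mc; have := mc' b;
        have := MayaP b mc'.
    have := ad (b + 1); have := ad (b - 1); have := mc'' b; have := MayaP b mc''.
    rewrite subrK; case: ifP => _; lia.
  split.
  - move=> b; rewrite /cp addrK.
    have := mc b.
    have [e|e] := eqVneq (res l' b) (i + 1).
      rewrite (site_next e).
      have [e1 e2] := hsite _ e.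
      have := ad b; have := h' b; have := MayaP b mc; have := mc' b; have := MayaP b mc'.
      have := ad (b + 1); have := ad (b - 1); have := mc'' b; have := MayaP b mc''.
      rewrite subrK; case: ifP => _; lia.
    have [e'|e'] := eqVneq (res l' (b + 1)) (i + 1); last by lia.
    have [e1 e2] := hsite _ e'; rewrite addrK in e1.
    have := ad b; have := h' b; have := mc' b; have := mc'' (b + 1); have := mc'' b.
    have := h' (b + 1); have := ad (b + 1); have := mc (b + 1); have := mc' (b + 1);
        have := ad (b + 1 + 1).
    case: ifP => _; lia.
  - move=> b; rewrite /cp; have := Kc b; have := Kc'' b.
    have := Kc (b - 1); have := Kc'' (b + 1); rewrite /vac_height.
    by do 2?case: ifP => _; lia.
  - by eexists; exact: bcp.
exists cp, (Sum (fun b => cp b - c b)); split=> //.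
  move=> b; rewrite /cp.
  have := ad b; have := h' b.
  have [e|e] := eqVneq (res l' b) (i + 1).
    have [e1 e2] := hsite _ e.
    have := mc b; have := MayaP b mc; have := mc' b; have := MayaP b mc'.
    have := ad (b + 1); have := ad (b - 1); have := mc'' b; have := MayaP b mc''.
    rewrite subrK; case: ifP => _; lia.
  rewrite (s' b e).
  have [e'|e'] := eqVneq (res l' (b + 1)) (i + 1); last by rewrite (s' (b + 1) e'); lia.
  have [e1 e2] := hsite _ e'; rewrite addrK in e1.
  have := h' (b + 1); have := ad (b + 1); have := mc (b + 1); have := mc' (b + 1).
  have := mc b; have := mc' b; have := mc'' b; have := mc'' (b + 1).
  lia.
rewrite row_wt_raise // (row_wt_up_move x oc oc' upcp up).
set n := Sum (fun b => cp b - c b).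
set Q := Sum _.
have fsec : finsupp (fun b => I i b * (c (b - 1) - c b - c' b + c' (b + 1))).
  exists (M + M' + M'' + `|kap|.+2)%N => b hb.
  have := bc b; have := bc' b; have := bc (b - 1); have := bc' (b + 1).
  by rewrite /vac_height => h1 h2 h3 h4; case: ifP => _; lia.
have fn' := finsupp_charged oc'' oc'.
have fn : finsupp (fun b => cp b - c b) by apply: finsupp_charged => //; case: upcp.
rewrite /row_phi /at_charge; case: (leqP (x (i + 1)) a) => xa.
  have : n <= n'.
    rewrite en'; apply: Sum_le => // b; rewrite /cp xa.
    by have := ad b; have := h' b; case: ifP => _; lia.
  move/(ler_wpM2l (ler0n _ (a - x (i + 1)%R)%N)); rewrite natz -(subzn xa) PoszD.
  have -> : (x (i + 1)%R - a)%N = 0%N by lia.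
  by rewrite -(subzn xa); case: ifP => _; nia.
have : Q <= n.
  apply: Sum_le => // b; rewrite /cp leqNgt xa /=.
  case: eqP => [e|_]; last by lia.
  have [e1 e2] := hsite _ e.
  have := ad b; have := h' b; have := mc b; have := MayaP b mc; have := mc' b;
      have := MayaP b mc'.
  have := ad (b + 1); have := ad (b - 1); have := mc'' b; have := MayaP b mc''.
  rewrite subrK; lia.
move/(ler_wpM2l (ler0n _ (x (i + 1)%R - a)%N)); rewrite natz -(subzn (ltnW xa)) PoszD.
have -> : (a - x (i + 1)%R)%N = 0%N by lia.
by case: ifP => _; nia.
Qed.

(** The mirror image of [row_raise_lift]: the choice is now on the far side. For a protected row the
    largest [c'] is taken, which gives [n' <= n]; otherwise the smallest, which makes the gain from
    raising at least [n]. *)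
Lemma row_raise_push i a x c cp c'' n : charged c -> charged c'' -> interlaced cp c'' ->
    up_move i c cp n ->
  exists c' n', [/\ charged c', up_move i c' c'' n', interlaced c c' &
    row_wt x cp c'' - a%:Z * n - at_charge i (x (i + 1)%R - a)%N <=
    row_wt (row_raise i a x) c c' - (row_phi i a x)%:Z * n'].
Proof.
move=> oc oc'' ad up; have [ocp h s en] := up.
have [mc Kc [M bc]] := oc; have [mcp Kcp [M' bcp]] := ocp; have [mc'' Kc'' [M'' bc'']] := oc''.
pose c' b := if res l' b == i + 1 then
    if (x (i + 1)%R <= a)%N then Num.min (c b) (c'' b) else Num.max (c (b - 1) - 1) (c'' (b
        + 1))
  else c'' b.
have hsite b : res l' b = i + 1 -> cp (b - 1) = c (b - 1) /\ cp (b + 1) = c (b + 1).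
  by move=> e; rewrite !s ?(site_prev e) ?(site_next e).
have oc' : charged c'.
  split.
  - move=> b; rewrite /c' addrK.
    have [e|e] := eqVneq (res l' b) (i + 1).
      rewrite (site_next e).
      have [e1 e2] := hsite _ e.
      have := ad b; have := h b; have := mc b; have := MayaP b mc; have := mcp b;
          have := MayaP b mcp.
      have := ad (b + 1); have := ad (b - 1); have := mc'' b; have := MayaP b mc''.
      rewrite subrK; case: ifP => _; lia.
    have [e'|e'] := eqVneq (res l' (b + 1)) (i + 1); last by apply: mc''.
    have [e1 e2] := hsite _ e'; rewrite addrK in e1.
    have := ad b; have := h b; have := mcp b; have := mc'' (b + 1); have := mc'' b.
    have := h (b + 1); have := ad (b + 1); have := mc (b + 1); have := mcp (b + 1);
        have := ad (b + 1 + 1); have := mc b.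
    case: ifP => _; lia.
  - move=> b; rewrite /c'; have := Kc b; have := Kc'' b.
    have := Kc (b - 1); have := Kc'' (b + 1); rewrite /vac_height.
    by do 2?case: ifP => _; lia.
  exists (M + M' + M'' + `|kap|.+2)%N => b hb; rewrite /c'.
  have := bc b; have := bc'' b; have := bc (b - 1); have := bc'' (b + 1).
  rewrite /vac_height => h1 h2 h3 h4.
  do 2?case: ifP => _; lia.
have up' : up_move i c' c'' (Sum (fun b => c'' b - c' b)).
  split => //.
  - move=> b; rewrite /c'; case: eqP => [e|_]; last by lia.
    have [e1 e2] := hsite _ e.
    have := ad b; have := h b; have := mc b; have := MayaP b mc; have := mcp b;
        have := MayaP b mcp.
    have := ad (b + 1); have := ad (b - 1); have := mc'' b; have := MayaP b mc''.
    rewrite subrK; case: ifP => _; lia.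
  - by move=> b /negbTE e; rewrite /c' e.
exists c', (Sum (fun b => c'' b - c' b)); split=> //.
  move=> b; rewrite /c'.
  have := ad b; have := h b.
  have [e|e] := eqVneq (res l' b) (i + 1).
    rewrite (site_next e).
    have [e1 e2] := hsite _ e.
    have := mc b; have := MayaP b mc; have := mcp b; have := MayaP b mcp.
    have := ad (b + 1); have := ad (b - 1); have := mc'' b; have := MayaP b mc''.
    rewrite subrK; case: ifP => _; lia.
  rewrite (s b e).
  have [e'|e'] := eqVneq (res l' (b + 1)) (i + 1); last by lia.
  have [e1 e2] := hsite _ e'; rewrite addrK in e1.
  have := h (b + 1); have := ad (b + 1); have := mc (b + 1); have := mcp (b + 1).
  have := mc b; have := mcp b; have := mc'' b; have := mc'' (b + 1).
  rewrite addrK; case: ifP => _; lia.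
rewrite row_wt_raise // (row_wt_up_move x oc oc' up up').
set n' := Sum (fun b => c'' b - c' b).
set Q := Sum _.
have [_ _ [M3 bc']] := oc'.
have fsec : finsupp (fun b => I i b * (c (b - 1) - c b - c' b + c' (b + 1))).
  exists (M + M' + M'' + M3 + `|kap|.+2)%N => b hb.
  have := bc b; have := bc' b; have := bc (b - 1); have := bc' (b + 1).
  by rewrite /vac_height => h1 h2 h3 h4; case: ifP => _; lia.
have fn' := finsupp_charged oc'' oc'.
have fn := finsupp_charged ocp oc.
rewrite /row_phi /at_charge; case: (leqP (x (i + 1)) a) => xa.
  have : n' <= n.
    rewrite en; apply: Sum_le => // b; rewrite /c' xa.
    by have := ad b; have := h b; case: ifP => _; lia.
  move/(ler_wpM2l (ler0n _ (a - x (i + 1)%R)%N)); rewrite natz -(subzn xa) PoszD.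
  have -> : (x (i + 1)%R - a)%N = 0%N by lia.
  by rewrite -(subzn xa); case: ifP => _; nia.
have : n <= Q.
  rewrite en; apply: Sum_le => // b; rewrite /c' leqNgt xa /=.
  case: eqP => [e|/eqP e]; last by rewrite s // subrr mul0r.
  rewrite (site_next e); have [e1 e2] := hsite _ e.
  have := ad b; have := h b; have := mc b; have := MayaP b mc; have := mcp b;
      have := MayaP b mcp.
  have := ad (b + 1); have := ad (b - 1); have := mc'' b; have := MayaP b mc''.
  rewrite subrK; lia.
move/(ler_wpM2l (ler0n _ (x (i + 1)%R - a)%N)); rewrite natz -(subzn (ltnW xa)) PoszD.
have -> : (a - x (i + 1)%R)%N = 0%N by lia.
by case: ifP => _; nia.
Qed.

End Weights.
End Rows.

(** * Runs along affine words and monotonicity of the amount raised *)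

Section Words.
Variables (l' : nat).
Local Notation Res := 'I_l'.+2.
Local Notation row := (row l').
Implicit Types (i j : Res) (x : row) (z : seq row) (v : seq Res).

(* A vacuum of level [k] on the right contributes [k] unmatched letters of
   residue 0 and no others. *)
Definition level (k : nat) i : nat := if i == 0 then k else 0%N.
Definition run k v z := foldl (fun z i => raise i (level k i) z) z v.
(* The letters of [v] at which no unmatched letter leaves [z] on the left. *)
Fixpoint kept k v z : seq Res :=
  if v is i :: v' then
    let r := kept k v' (raise i (level k i) z) in
    if list_phi i (level k i) z == 0%N then i :: r else r
  else [::].

Lemma run_cat k u v z : run k (u ++ v) z = run k v (run k u z).
Proof. by rewrite /run foldl_cat. Qed.

Lemma size_run k v z : size (run k v z) = size z.
Proof. by elim: v z => //= i v IH z; rewrite IH size_raise. Qed.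

Lemma take_raise n i a z : raise i a (take n z) = take n (raise i a z).
Proof. by elim: z n a => [|x z IH] [|n] a //=; rewrite IH. Qed.

Lemma take_run n k v z : run k v (take n z) = take n (run k v z).
Proof. by elim: v z => //= i v IH z; rewrite take_raise IH. Qed.

Section Charge.
Variable kap : int.
Local Notation K := (vac_height kap).
Local Notation charged := (charged kap).
Local Notation up_move := (up_move kap).
Local Notation chain := (chain kap).
Implicit Types (c d : int -> int).

Lemma charged_vac : charged K.
Proof.
split=> //; first exact: Maya_vac_height.
by exists 0%N => n _; rewrite subrr.
Qed.

(** The move travels from the far end to the head. The price [row_phi] on the far side of a row is
    the price on the near side of the next one, so intermediate prices cancel. *)
Lemma chain_raise_lift i a z c c' c'' w1 n' : charged c -> chain (raise i a z) c c' w1 ->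
    up_move i c' c'' n' ->
  exists cp n w2, [/\ up_move i c cp n, chain z cp c'' w2 &
    w1 - (list_phi i a z)%:Z * n' <= w2 - a%:Z * n - at_charge kap i (list_raised i a z)].
Proof.
elim: z a c w1 => [|x z IH] a c w1 oc /=.
  move=> [-> ->] up; exists c'', n', 0; split=> //.
  by rewrite /at_charge if_same subr0.
move=> [c1 [w [oc1 ad fm ->]]] up.
have [c1p [n1 [w2 [up1 fm2 le1]]]] := IH _ _ _ oc1 fm up.
have [cp [n [upcp adp le2]]] := row_raise_lift a x oc oc1 ad up1.
exists cp, n, (row_wt kap x cp c1p + w2); split=> //.
  by exists c1p, w2; split=> //; case: up1.
by move: le1 le2; rewrite /at_charge; case: ifP => _; lia.
Qed.

Lemma chain_raise_push i a z c cp c'' w2 n : charged c -> chain z cp c'' w2 ->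
    up_move i c cp n ->
  exists c' n' w1, [/\ chain (raise i a z) c c' w1, up_move i c' c'' n' &
    w2 - a%:Z * n - at_charge kap i (list_raised i a z) <= w1 - (list_phi i a z)%:Z * n'].
Proof.
elim: z a c cp w2 n => [|x z IH] a c cp w2 n oc /=.
  move=> [-> ->] up; exists c, n, 0; split=> //.
  by rewrite /at_charge if_same subr0.
move=> [c1p [w [oc1 ad fm ->]]] up.
have [c1 [n1 [oc1' up1 ad1 le1]]] := row_raise_push a x oc oc1 ad up.
have [c' [n' [w1 [fm1 up' le2]]]] := IH (row_phi i a x) _ _ _ _ oc1' fm up1.
exists c', n', (row_wt kap (row_raise i a x) c c1 + w1); split=> //.
  by exists c1, w1; split.
by move: le1 le2; rewrite /at_charge; case: ifP => _; lia.
Qed.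

Lemma up_move_id i c : charged c -> up_move i c c 0.
Proof.
move=> oc; split=> // [b|]; first by lia.
by rewrite (_ : (fun b => _) = fun=> 0) ?Sum_zero //; apply/funext => b; rewrite subrr.
Qed.

Lemma up_move_ge0 i c c' n : up_move i c c' n -> 0 <= n.
Proof. by move=> [_ h _ ->]; apply: Sum_ge0 => b; have := h b; lia. Qed.

Lemma up_move0 i c c' : charged c -> up_move i c c' 0 -> c' = c.
Proof.
move=> oc [oc' h _ /esym s0]; apply/funext => b.
have h0 b' : 0 <= c' b' - c b' by have := h b'; lia.
by apply/eqP; rewrite -subr_eq0; apply/eqP/(Sum_eq0 (finsupp_charged oc' oc) h0 s0).
Qed.

Lemma up_move_le_act i c c' n b : Maya c -> up_move i c c' n -> c' b <= act i c b.
Proof.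
move=> mc [[mc' _ _] h s _]; rewrite /act; case: eqP => [e|/eqP e]; last by rewrite s.
have := s (b - 1); have := s (b + 1).
rewrite (site_next e) (site_prev e) => /(_ isT) <- /(_ isT) <-.
by have := mc' b; have := MayaP b mc'; lia.
Qed.

Lemma up_move_act i c : charged c -> exists n, up_move i c (act i c) n.
Proof.
move=> oc; have [mc Kc [M bc]] := oc; eexists; split; last reflexivity.
- split; first exact: act_Maya.
    by move=> b; apply: le_trans (Kc b) _; exact: act_infl.
  exists (M + `|kap|.+2)%N => b hb; rewrite /act.
  have := bc b; have := bc (b + 1); have := bc (b - 1); rewrite /vac_height.
  by case: ifP => _; lia.
- move=> b; rewrite act_infl //= /act; case: ifP => _; last by lia.
  by have := MayaP b mc; lia.
- by move=> b /negbTE e; rewrite /act e.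
Qed.

Lemma chain_vac z : chain z K K 0.
Proof.
elim: z => //= x z IH; exists K, 0; split=> //; first exact: charged_vac.
  by move=> b; rewrite /vac_height; lia.
rewrite /row_wt (_ : (fun n => _) = fun=> 0) ?Sum_zero //.
by apply/funext => n; rewrite !subrr !mulr0.
Qed.

Lemma chain_vac_inv z c w : chain z K c w -> c = K /\ w = 0.
Proof.
elim: z c w => [|x z IH] c w /=; first by case=> <- ->.
move=> [c1 [w1 [[_ h _] ad fm ->]]].
have e : c1 = K by apply/funext => b; have := ad b; have := h b; lia.
rewrite e in fm *; have [-> ->] := IH _ _ fm; split=> //.
rewrite /row_wt (_ : (fun n => _) = fun=> 0) ?Sum_zero //.
by apply/funext => n; rewrite !subrr !mulr0.
Qed.

(** Times [k], this collects the prices [level k i * n] paid at the head: they arise only for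
    [i = 0], whose moves take place at sites of residue 1. *)
Definition level_defect c : int := Sum (fun b => if res l' b == 1 then c b - K b else 0).

Lemma level_defect_up_move i k c c' n : charged c -> up_move i c c' n ->
  k%:Z * level_defect c' = k%:Z * level_defect c + (level k i)%:Z * n.
Proof.
move=> oc [oc' h s ->].
have [_ _ fc] := oc; have [_ _ fc'] := oc'.
have fi c0 : finsupp c0 -> finsupp (fun b => if res l' b == 1 then c0 b else 0).
  by move=> f0; apply: finsupp_supp f0 _ => n0 ->; rewrite if_same.
have -> : level_defect c' = level_defect c + Sum (fun b =>
    if res l' b == 1 then c' b - c b else 0).
  have f1 := fi _ fc; have f2 := fi _ (finsupp_charged oc' oc); rewrite /level_defect -SumD //.
  by congr Sum; apply/funext => b; case: ifP => _; lia.
rewrite mulrDr; congr (_ + _); rewrite /level; have [i0|i0] := eqVneq i 0.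
  congr (_ * Sum _); apply/funext => b; rewrite i0 add0r in s.
  by have := s b; case: eqP => // _ /(_ isT) ->; rewrite subrr.
rewrite mul0r (_ : (fun b => _) = fun=> 0) ?Sum_zero ?mulr0 //.
apply/funext => b; case: eqP => // e; rewrite s ?subrr // e eq_sym.
by rewrite -subr_eq0 addrK.
Qed.

(* [w] is the price of reaching [c] from the vacuum along [v], a move of residue
   [i] costing the number of unmatched letters that leave the list. *)
Fixpoint lowering k v z c (w : int) : Prop :=
  if v is i :: v' then
    exists c1 n w1, [/\ lowering k v' (raise i (level k i) z) c1 w1, up_move i c1 c n &
      w = w1 + (list_phi i (level k i) z)%:Z * n]
  else c = K /\ w = 0.

Fixpoint raised_total k v z : int :=
  if v is i :: v' then
    at_charge kap i (list_raised i (level k i) z) + raised_total k v' (raise i (level k i) z)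
  else 0.

Lemma lowering_charged k v z c w : lowering k v z c w -> charged c /\ 0 <= w.
Proof.
elim: v z c w => [|i v IH] z c w /=; first by move=> [-> ->]; split=> //; exact: charged_vac.
move=> [c1 [n [w1 [/IH[oc1 w10] up ->]]]]; split; first by case: up.
by rewrite addr_ge0 // mulr_ge0 //; exact: up_move_ge0 up.
Qed.

Lemma lowering_vac k v z : lowering k v z K 0.
Proof.
elim: v z => //= i v IH z; exists K, 0, 0; split=> //.
  by apply: up_move_id; exact: charged_vac.
by rewrite mulr0 addr0.
Qed.

Lemma lowering_kept k v z : lowering k v z (acts (kept k v z) K) 0.
Proof.
elim: v z => //= i v IH z.
have := IH (raise i (level k i) z); set c1 := acts _ K => h.
have [oc1 _] := lowering_charged h.
case: eqP => [e|_].
  have [n up] := up_move_act i oc1; exists c1, n, 0; split=> //.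
  by rewrite e mul0r addr0.
exists c1, 0, 0; split=> //; first exact: up_move_id.
by rewrite mulr0 addr0.
Qed.

(** A nontrivial move is free only if [list_phi] vanishes, that is, at a kept letter. With
    [lowering_kept], the kept word therefore computes the largest height reachable at no cost, which
    ties kept words to the order on words. *)
Lemma lowering0_le k v z c b : lowering k v z c 0 -> c b <= acts (kept k v z) K b.
Proof.
elim: v z c b => [|i v IH] z c b /=; first by case=> ->.
move=> [c1 [n [w1 [h up e]]]].
have [oc1 w10] := lowering_charged h; have n0 := up_move_ge0 up.
have p0 : 0 <= (list_phi i (level k i) z)%:Z * n by rewrite mulr_ge0.
have e0 : w1 = 0 by lia.
subst w1; move: e; rewrite add0r => /esym/eqP; rewrite mulf_eq0 => e.
have {}IH := IH _ _ _ h.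
have [mc1 _ _] := oc1.
case: ifP => e1 /=.
  apply: le_trans (up_move_le_act b mc1 up) _; exact: act_mono.
case/orP: e => [e|/eqP e]; first by move: e1; rewrite -(eqr_nat int) natz e.
by rewrite e in up; rewrite (up_move0 oc1 up).
Qed.

(* The next two lemmas say that the cheapest way of reaching [c] along [v] costs
   [raised_total k v z] minus the largest weight, corrected by the level defect,
   of a chain ending at [c] that starts between the vacuum and [acts v] of it. *)
Lemma lowering_chain k v z c w : lowering k v z c w ->
  exists c0 w0, [/\ charged c0, (forall b, c0 b <= acts v K b), chain z c0 c w0 &
    - w <= w0 - k%:Z * level_defect c0 - raised_total k v z].
Proof.
elim: v z c w => [|i v IH] z c w /=.
  move=> [-> ->]; exists K, 0; split=> //; [exact: charged_vac|exact: chain_vac|].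
  rewrite /level_defect (_ : (fun b => _) = fun=> 0) ?Sum_zero ?mulr0 //.
  by apply/funext => b; rewrite subrr if_same.
move=> [c1 [n [w1 [/IH[c01 [w01 [oc01 le01 fm le1]]] up ->]]]].
have [cp [m [w2 [upcp fm2 le2]]]] := chain_raise_lift oc01 fm up.
have [ocp _ _ _] := upcp; have [mc01 _ _] := oc01.
exists cp, w2; split=> //.
  by move=> b; apply: le_trans (up_move_le_act b mc01 upcp) _; exact: act_mono.
by rewrite (level_defect_up_move k oc01 upcp); lia.
Qed.

Lemma chain_lowering k v z c c0 w0 : charged c0 -> (forall b, c0 b <= acts v K b) ->
    chain z c0 c w0 ->
  exists w, lowering k v z c w /\ w0 - k%:Z * level_defect c0 - raised_total k v z <= - w.
Proof.
elim: v z c c0 w0 => [|i v IH] z c c0 w0 oc0 le0 fm /=.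
  have e : c0 = K.
    by apply/funext => b; have := le0 b; have [_ + _] := oc0 => /(_ b); rewrite /=; lia.
  rewrite e in fm *; have [-> ->] := chain_vac_inv fm; exists 0; split=> //.
  rewrite /level_defect (_ : (fun b => _) = fun=> 0) ?Sum_zero ?mulr0 //.
  by apply/funext => b; rewrite subrr if_same.
pose K1 := acts v K.
have mK1 : Maya K1 by apply: acts_Maya; exact: Maya_vac_height.
have KK1 b : K b <= K1 b by apply: acts_infl; exact: Maya_vac_height.
(* Truncating [c0] at the height reached by [v] leaves a difference supported on sites of residue
   [i + 1], which is the move to be made by [i]. *)
pose c1 b := Num.min (c0 b) (K1 b).
have [mc0 Kc0 [M bc0]] := oc0.
have oc1 : charged c1.
  split.
  - by move=> b; rewrite /c1; have := mc0 b; have := mK1 b; lia.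
  - by move=> b; rewrite /c1; have := Kc0 b; have := KK1 b; lia.
  exists M => b hb; rewrite /c1; have := bc0 b hb; have := KK1 b; lia.
have up : up_move i c1 c0 (Sum (fun b => c0 b - c1 b)).
  split=> //.
  - move=> b; rewrite /c1; have := le0 b; rewrite /= -/K1 /act; case: ifP => _.
      by have := MayaP b mK1; lia.
    by lia.
  - by move=> b /negbTE e; rewrite /c1; have := le0 b; rewrite /= -/K1 /act e; lia.
have [c' [n' [w1 [fm1 up' le1]]]] := chain_raise_push (level k i) oc1 fm up.
have le1' b : c1 b <= acts v K b by rewrite /c1 -/K1; lia.
have [w [h lew]] := IH _ _ _ _ oc1 le1' fm1.
exists (w + (list_phi i (level k i) z)%:Z * n'); split; first by exists c', n', w.
by rewrite (level_defect_up_move k oc1 up); lia.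
Qed.

(** By the two preceding lemmas the total is the maximum of [w0 - k * level_defect c0] over chains
    from some [c0] below [acts v] of the vacuum to the vacuum; a larger word admits more chains. *)
Lemma raised_total_mono k v v' z : height_le v v' -> raised_total k v z <= raised_total k v' z.
Proof.
move=> vv; have [c0 [w0 [oc0 le0 fm le1]]] := lowering_chain (lowering_vac k v z).
have le0' b : c0 b <= acts v' K b by apply: le_trans (le0 b) _; exact: vv.
have [w [h lew]] := chain_lowering k oc0 le0' fm; have [_ w00] := lowering_charged h.
by lia.
Qed.

Lemma raised_total_cat k u v z : raised_total k (u ++ v) z = raised_total k u z +
    raised_total k v (run k u z).
Proof. by elim: u z => [|i u IH] z /=; rewrite ?add0r // IH addrA. Qed.

Lemma kept_mono k v v' z : height_le v v' -> raised_total k v' z = raised_total k v z ->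
    forall b,
  acts (kept k v z) K b <= acts (kept k v' z) K b.
Proof.
move=> vv e b; have [c0 [w0 [oc0 le0 fm le1]]] := lowering_chain (lowering_kept k v z).
have le0' b' : c0 b' <= acts v' K b' by apply: le_trans (le0 b') _; exact: vv.
have [w [h lew]] := chain_lowering k oc0 le0' fm; have [_ w00] := lowering_charged h.
(* Equality of the totals leaves no room for a positive price, so the height kept by [v] is free for
   [v'] too. *)
have w0E : w = 0 by lia.
by rewrite w0E in h; exact: lowering0_le h.
Qed.

Section PartialRaise.
Variables (k : nat) (i : Res) (a : nat) (z : seq row).
Let z1 := raise i (level k i + a)%N z.
Let D1 := at_charge kap i (list_raised i (level k i + a)%N z).
Let phi1 := list_phi i (level k i + a)%N z.

(** The chain is pushed along the trivial move at its head, so the surplus [a] costs nothing. *)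
Lemma raised_total_raise_le v : raised_total k v z <= D1 + raised_total k v z1.
Proof.
have [c0 [w0 [oc0 le0 fm le1]]] := lowering_chain (lowering_vac k v z).
have [c' [n' [w1 [fm1 up' le2]]]] :=
    chain_raise_push (level k i + a)%N oc0 fm (up_move_id i oc0).
have [w [h lew]] := chain_lowering k oc0 le0 fm1; have [_ w00] := lowering_charged h.
have n0 := up_move_ge0 up'.
have : 0 <= phi1%:Z * n' by rewrite mulr_ge0.
by rewrite /D1 /phi1 /z1; lia.
Qed.

Lemma raise_lift v c1 c n' : lowering k v z1 c1 0 -> up_move i c1 c n' -> phi1%:Z * n' = 0 ->
  exists c0 cp n w2, [/\ charged c0, (forall b, c0 b <= acts v K b),
    up_move i c0 cp n, chain z cp c w2 &
    raised_total k v z1 + D1 + a%:Z * n <= w2 - k%:Z * level_defect cp].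
Proof.
move=> h up e; have [c0 [w0 [oc0 le0 fm le1]]] := lowering_chain h.
have [cp [n [w2 [upcp fm2 le2]]]] := chain_raise_lift oc0 fm up.
exists c0, cp, n, w2; split=> //; rewrite (level_defect_up_move k oc0 upcp).
move: le2 le1; rewrite -/phi1 -/D1 -/z1 e PoszD mulrDl; lia.
Qed.

Lemma raised_total_raise_ge v c1 c n' : lowering k v z1 c1 0 -> up_move i c1 c n' ->
    phi1%:Z * n' = 0 ->
  (0 < a)%N -> raised_total k (i :: v) z <= D1 + raised_total k v z1 ->
  exists w, lowering k v z c w /\ D1 + raised_total k v z1 - raised_total k v z <= - w.
Proof.
move=> h up e a0 le; have [c0 [cp [n [w2 [oc0 le0 upcp fm le1]]]]] := raise_lift h up e.
have [ocp _ _ _] := upcp; have [mc0 _ _] := oc0.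
have lep b : cp b <= acts (i :: v) K b.
  by apply: le_trans (up_move_le_act b mc0 upcp) _; exact: act_mono.
have [w [h' lew]] := chain_lowering k ocp lep fm; have [_ w00] := lowering_charged h'.
have n0 := up_move_ge0 upcp.
(* A nontrivial move at the head would gain [a * n > 0] over the total of [i :: v], against the
   assumed bound. *)
have nE : n = 0 by nia.
rewrite nE in upcp le1; rewrite (up_move0 oc0 upcp) in fm le1.
have [w' [h2 lew']] := chain_lowering k oc0 le0 fm; exists w'; split=> //.
by lia.
Qed.

Lemma kept_raise_le v b : raised_total k v z = D1 + raised_total k v z1 ->
  acts (kept k v z) K b <= acts (if phi1 == 0%N then i :: kept k v z1 else kept k v z1) K b.
Proof.
move=> e; have [c0 [w0 [oc0 le0 fm le1]]] := lowering_chain (lowering_kept k v z).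
have [c' [n' [w1 [fm1 up' le2]]]] :=
    chain_raise_push (level k i + a)%N oc0 fm (up_move_id i oc0).
have [w [h lew]] := chain_lowering k oc0 le0 fm1;
    have [[mc' Kc' fc'] w00] := lowering_charged h.
have n0 := up_move_ge0 up'.
have p0 : 0 <= phi1%:Z * n' by rewrite mulr_ge0.
move: le2; rewrite -/phi1 -/D1 => le2; move: lew; rewrite -/z1 => lew.
have wE : w = 0 by lia.
have pE : phi1%:Z * n' = 0 by lia.
rewrite wE in h; have lec' := fun b => lowering0_le b h.
case: (phi1 =P 0%N) => [p|p] /=.
  apply: le_trans (up_move_le_act b mc' up') _; exact: act_mono.
have nE : n' = 0 by nia.
by rewrite nE in up'; rewrite (up_move0 _ up').
Qed.

Lemma kept_raise_ge v b : (0 < a)%N -> raised_total k (i :: v) z = D1 + raised_total k v z1 ->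
  raised_total k v z = D1 + raised_total k v z1 ->
  acts (if phi1 == 0%N then i :: kept k v z1 else kept k v z1) K b <= acts (kept k v z) K b.
Proof.
move=> a0 e1 e2; have h := lowering_kept k v z1; have [oc1 _] := lowering_charged h.
have [n' [up p]] : exists n', up_move i (acts (kept k v z1) K)
    (acts (if phi1 == 0%N then i :: kept k v z1 else kept k v z1) K) n' /\ phi1%:Z * n' = 0.
  case: eqP => [->|_]; last by exists 0; rewrite mulr0; split=> //; exact: up_move_id.
  by have [n up] := up_move_act i oc1; exists n; rewrite mul0r.
have [|w [h' lew]] := raised_total_raise_ge h up p a0; first by rewrite e1.
have [_ w00] := lowering_charged h'; have wE : w = 0 by lia.
by rewrite wE in h'; exact: lowering0_le h'.
Qed.

End PartialRaise.

End Charge.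

Definition letter_total j z : nat := (\sum_(x <- z) x j)%N.

Lemma letter_total_raise j i a z :
  (letter_total j (raise i a z) + (if (i + 1)%R == j then list_raised i a z else 0) =
   letter_total j z + (if i == j then list_raised i a z else 0))%N.
Proof.
rewrite /letter_total; elim: z a => [|x z IH] a /=; first by rewrite !big_nil !if_same.
rewrite !big_cons; move: (IH (row_phi i a x)).
rewrite /row_raise [i == j]eq_sym [i + 1 == j]eq_sym.
have [->|_] := eqVneq j i; first by rewrite eq_sym succ_neq; lia.
by have [->|_] := eqVneq j (i + 1); lia.
Qed.

Lemma res_nat (j : Res) : res l' (j : nat)%:Z = j.
Proof. by rewrite /res -pmulrn natr_Zp. Qed.

(** This is why totals carry a charge: charge [j + 1] counts the raisings that create letters [j],
    and charge [j] those that destroy them. *)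
Lemma letter_total_run j k v z : (letter_total j (run k v z))%:Z =
  (letter_total j z)%:Z + raised_total ((j : nat)%:Z + 1) k v z - raised_total (j : nat)%:Z
      k v z.
Proof.
elim: v z => [|i v IH] z /=; first by rewrite subr0 addr0.
rewrite IH; have := letter_total_raise j i (level k i) z.
rewrite /at_charge resS res_nat (inj_eq (addIr 1)) [i == j]eq_sym [i + 1 == j]eq_sym.
by do 2?case: ifP => _; lia.
Qed.

(** Since runs commute with [take], totals on prefixes are within reach of the numerical comparison,
    and they recover the rows one by one. *)
Lemma eq_from_letter_total z z' : size z = size z' ->
  (forall n j, letter_total j (take n z) = letter_total j (take n z')) -> z = z'.
Proof.
elim: z z' => [|x z IH] [|x' z'] //= [sz] h.
have e : x = x'.
  by apply/funext => j; have := h 1%N j; rewrite /= !take0 /letter_total !big_seq1.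
subst x'; congr (_ :: _); apply: IH => // n j.
by have := h n.+1 j; rewrite /= /letter_total !big_cons => /addnI.
Qed.

Definition highest k z := forall i, raise i (level k i) z = z.

Lemma list_raised_highest i a z : raise i a z = z -> list_raised i a z = 0%N.
Proof.
elim: z a => //= x z IH a [e /IH ->]; rewrite addn0.
by have := congr1 (fun f => f i) e; rewrite /row_raise eqxx; lia.
Qed.

Lemma raised_total_highest kap k v z : highest k z -> raised_total kap k v z = 0.
Proof.
move=> hz; elim: v => //= i v IH; rewrite hz list_raised_highest ?hz // IH.
by rewrite /at_charge if_same addr0.
Qed.

Lemma highest_take n k z : highest k z -> highest k (take n z).
Proof. by move=> hz i; rewrite take_raise hz. Qed.

(** The word [v'] lies between [v] and [v ++ v'], and the latter raises no more than [v] because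
    nothing is left to raise after [v]. *)
Lemma raised_total_height_le kap k v v' z : highest k (run k v z) -> height_le v v' ->
  raised_total kap k v' z = raised_total kap k v z.
Proof.
move=> hz vv; apply/le_anti/andP; split; last exact: raised_total_mono.
apply: le_trans (raised_total_mono kap k z (height_le_suffix v v')) _.
by rewrite raised_total_cat [X in _ + X]raised_total_highest ?addr0 ?lexx.
Qed.

Lemma run_height_le k v v' z : highest k (run k v z) -> height_le v v' ->
    run k v' z = run k v z.
Proof.
move=> hz vv; apply: eq_from_letter_total; first by rewrite !size_run.
move=> n j; rewrite -!take_run; apply/eqP; rewrite -eqz_nat !letter_total_run.
have hn : highest k (run k v (take n z)) by rewrite take_run; exact: highest_take.
by rewrite !(raised_total_height_le _ hn vv).
Qed.

Lemma kept_height_le k v v' z : highest k (run k v z) -> height_le v v' ->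
    height_le (kept k v z) (kept k v' z).
Proof. by move=> hz vv kap b; apply: kept_mono => //; exact: raised_total_height_le. Qed.

Section PartialRaiseRun.
Variables (k : nat) (i : Res) (a : nat) (v : seq Res).
Hypothesis a0 : (0 < a)%N.
Let ra z := raise i (level k i + a)%N z.

Lemma raised_total_raise_fwd kap z : highest k (run k v z) ->
  raised_total kap k v z = at_charge kap i (list_raised i (level k i + a)%N z) +
      raised_total kap k v (ra z).
Proof.
move=> hz; apply/le_anti/andP; split; first exact: raised_total_raise_le.
have := up_move_id i (charged_vac kap) =>
    /(raise_lift (lowering_vac kap k v (ra z))) [|c0 [cp [n [w2 []]]]].
  by rewrite mulr0.
move=> oc0 le0 upcp fm le1.
have [ocp _ _ _] := upcp; have [mc0 _ _] := oc0.
have lep b : cp b <= acts (i :: v) (vac_height kap) b.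
  by apply: le_trans (up_move_le_act b mc0 upcp) _; exact: act_mono.
have [w [h' lew]] := chain_lowering k ocp lep fm; have [_ w00] := lowering_charged h'.
have n0 := up_move_ge0 upcp.
rewrite (raised_total_height_le _ hz (height_le_consr i v)) in lew.
by have : 0 <= a%:Z * n by [rewrite mulr_ge0]; rewrite /ra; lia.
Qed.

Lemma raised_total_raise_bwd kap z : highest k (run k v (ra z)) ->
  raised_total kap k v z = at_charge kap i (list_raised i (level k i + a)%N z) +
      raised_total kap k v (ra z).
Proof.
move=> hz; apply/le_anti/andP; split; first exact: raised_total_raise_le.
have := up_move_id i (charged_vac kap) =>
    /(raised_total_raise_ge (lowering_vac kap k v (ra z))) [|//||w [h lew]].
- by rewrite mulr0.
- rewrite -(raised_total_height_le _ hz (height_le_consr i v)).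
  exact: raised_total_raise_le.
by have [_ w0] := lowering_charged h; rewrite /ra; lia.
Qed.

Lemma run_raise_eq z :
  (forall kap n, raised_total kap k v (take n z) =
     at_charge kap i (list_raised i (level k i + a)%N (take n z)) + raised_total kap k v
         (ra (take n z))) ->
  run k v (ra z) = run k v z.
Proof.
move=> h; apply: eq_from_letter_total; first by rewrite !size_run size_raise.
move=> n j; rewrite -!take_run -take_raise; apply/eqP; rewrite -eqz_nat !letter_total_run !h.
have := letter_total_raise j i (level k i + a)%N (take n z).
rewrite /at_charge resS res_nat (inj_eq (addIr 1)) [i == j]eq_sym [i + 1 == j]eq_sym /ra.
by do 2?case: ifP => _; lia.
Qed.

(** A highest end on either side forces equal totals, up to the first raising; the property passes
    to prefixes, and these determine the run. *)
Lemma run_raise_highest z : highest k (run k v z) \/ highest k (run k v (ra z)) ->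
  run k v (ra z) = run k v z.
Proof.
move=> hz; apply: run_raise_eq => kap n; case: hz => /(highest_take n);
    rewrite -take_run => hz.
  exact: raised_total_raise_fwd.
by apply: raised_total_raise_bwd; rewrite /ra take_raise.
Qed.

Lemma kept_raise_highest z : highest k (run k v z) ->
  let r := if list_phi i (level k i + a)%N z == 0%N then i :: kept k v (ra z) else kept k v
      (ra z) in
  height_le (kept k v z) r /\ height_le r (kept k v z).
Proof.
move=> hz r; have e kap := raised_total_raise_fwd kap hz.
split=> kap b; first exact: kept_raise_le.
apply: kept_raise_ge => //; rewrite (raised_total_height_le _ hz (height_le_consr i v));
    exact: e.
Qed.

End PartialRaiseRun.
End Words.

(** * The combinatorial R-matrix and splitting of levels *)

Section Exchange.
Variables (l' : nat).
Local Notation Res := 'I_l'.+2.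
Local Notation row := (row l').
Implicit Types (i j r s : Res) (x y z : row) (ys zs : seq row).

Definition row_size x : nat := (\sum_j x j)%N.
Definition add_rows x y : row := fun j => (x j + y j)%N.
Definition delta r (m : nat) : row := fun j => if j == r then m else 0%N.

Lemma row_sizeD x y : row_size (add_rows x y) = (row_size x + row_size y)%N.
Proof. by rewrite /row_size -big_split. Qed.

Lemma row_size_shift x : (\sum_j x (j + 1)%R)%N = row_size x.
Proof.
rewrite /row_size; have h : bijective (fun j => j + 1 : Res).
  by exists (fun j => j - 1) => j; rewrite ?addrK ?subrK.
by rewrite [RHS](reindex (fun j => j + 1)) //; exact: onW_bij.
Qed.

Lemma row_size_delta r m : row_size (delta r m) = m.
Proof.
rewrite /row_size (bigD1 r) //= /delta eqxx big1 ?addn0 // => j /negbTE ->.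
by [].
Qed.

Lemma row_size_ge x j : (x j <= row_size x)%N.
Proof. by rewrite /row_size (bigD1 j) //= leq_addr. Qed.

Lemma row_size_row_raise i a x : row_size (row_raise i a x) = row_size x.
Proof.
have ni : i + 1 != i by rewrite succ_neq.
rewrite /row_size (bigD1 i) //= (bigD1 (i + 1)) //= [RHS](bigD1 i) //= [in RHS](bigD1 (i +
    1)) //=.
rewrite /row_raise eqxx (negbTE ni) eqxx.
under eq_bigr => j /andP[/negbTE -> /negbTE ->] do idtac.
by lia.
Qed.

(** The function and its rotation have the same sum, so every inequality around the cycle is an
    equality. *)
Lemma cycle_const (c : row) : (forall j, (c (j + 1)%R <= c j)%N) -> forall j, c (j + 1) = c j.
Proof.
move=> h j; have e := row_size_shift c; move: e; rewrite /row_size.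
have := @leqif_sum _ predT (fun j => c (j + 1) == c j) (fun j => c (j + 1)) c.
move=> /(_ (fun j _ => leqif_eq (h j))) [_ h2] e.
by move: h2; rewrite e eqxx => /esym/forallP/(_ j)/eqP.
Qed.

Lemma cycle_const_inc (c : row) : (forall j, (c j <= c (j + 1)%R)%N) ->
  forall j, c (j + 1) = c j.
Proof.
move=> h j; have e := row_size_shift c; move: e; rewrite /row_size.
have := @leqif_sum _ predT (fun j => c j == c (j + 1)) c (fun j => c (j + 1)).
move=> /(_ (fun j _ => leqif_eq (h j))) [_ h2] e.
by move: h2; rewrite e eqxx => /esym/forallP/(_ j)/eqP.
Qed.

(* The combinatorial R-matrix [x (x) y |-> y' (x) x'] of one-row crystals, with
   the carrier [c] of the box-ball update and the free letters [U]. *)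
Definition Rmatrix y x x' y' := exists U c : row,
  [/\ forall j, x j = (y' j + U j)%N, forall j, x' j = (y j + U j)%N,
      forall j, (c j + y j = c (j + 1)%R + y' (j + 1)%R)%N &
      forall j, c j = 0%N \/ U j = 0%N].

Lemma Rmatrix_size y x x' y' : Rmatrix y x x' y' ->
    row_size y' = row_size y /\ row_size x' = row_size x.
Proof.
move=> [U [c [hx hx' hc _]]].
have ey : row_size y' = row_size y.
  have := eq_bigr _ (fun j _ => hc j : _ = _) : (\sum_j (c j + y j) = \sum_j _)%N.
  rewrite !big_split /= (row_size_shift c) (row_size_shift y') => /addnI; exact: esym.
split=> //.
have -> : x = add_rows y' U by apply/funext.
have -> : x' = add_rows y U by apply/funext.
by rewrite !row_sizeD ey.
Qed.

(** Raising changes entries at [i] and [i + 1] only, and the balance equations dictate the new free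
    letters and carrier there. *)
Lemma Rmatrix_raise i a y x x' y' : Rmatrix y x x' y' ->
  row_phi i (row_phi i a y) x = row_phi i (row_phi i a x') y' /\
  Rmatrix (row_raise i a y) (row_raise i (row_phi i a y) x) (row_raise i a x') (row_raise i
      (row_phi i a x') y').
Proof.
move=> [U [c [hx hx' hc hU]]].
have ni : (i + 1 == i) = false by rewrite succ_neq.
have x0 := hx i; have x1 := hx (i + 1); have x0' := hx' i; have x1' := hx' (i + 1).
have c0 := hc i; have U0 := hU i; have U1 := hU (i + 1).
rewrite /row_phi; split; first by lia.
pose dy := (y (i + 1)%R - a)%N; pose dy' := (y' (i + 1)%R - row_phi i a x')%N.
pose dx := (x (i + 1)%R - row_phi i a y)%N.
exists (fun j => if j == i then (U i + dx - dy')%N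
          else if j == i + 1 then (U (i + 1)%R + dy' - dx)%N else U j).
exists (fun j => if j == i then (c i - dy')%N
          else if j == i + 1 then (c (i + 1)%R + dy)%N else c j).
rewrite /dx /dy /dy' /row_raise /row_phi.
split=> j.
- have := hx j; have [->|_] := eqVneq j i; first by lia.
  by have [->|_] := eqVneq j (i + 1); lia.
- have := hx' j; have [->|_] := eqVneq j i; first by lia.
  by have [->|_] := eqVneq j (i + 1); lia.
- have := hc j; rewrite (inj_eq (addIr 1)).
  have [->|_] := eqVneq j i; first by rewrite ni; lia.
  have [->|n1] := eqVneq j (i + 1).
    by have [->|_] := eqVneq (i + 1 + 1) i; lia.
  by have [->|_] := eqVneq (j + 1) i; lia.
- have := hU j; have [->|_] := eqVneq j i; first by lia.
  by have [->|_] := eqVneq j (i + 1); lia.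
Qed.

Section Existence.
Variables (x y : row).
Hypothesis le_yx : (row_size y <= row_size x)%N.

(* The carrier is the periodic solution of a Lindley recursion. *)
Fixpoint lindley (c0 n : nat) : nat :=
  if n is n'.+1 then (lindley c0 n' + y n'%:R - x n'.+1%:R)%N else c0.

Let drift n : int := \sum_(0 <= k < n) ((y k%:R)%:Z - (x k.+1%:R)%:Z).

Lemma lindleyE c0 n : (lindley c0 n)%:Z = Num.max (lindley 0 n)%:Z (c0%:Z + drift n).
Proof.
elim: n => [|n IH] /=; first by rewrite /drift big_nil; lia.
by rewrite /drift big_nat_recr //= -/(drift n); lia.
Qed.

Lemma drift_le0 : drift l'.+2 <= 0.
Proof.
have h z : row_size z = (\sum_(k < l'.+2) z (k%:R : Res))%N.
  by apply: eq_bigr => k _; congr z; rewrite natr_Zp.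
rewrite /drift big_mkord sumrB subr_le0.
have -> : \sum_(k < l'.+2) (y (k%:R : Res))%:Z = (row_size y)%:Z.
  by rewrite h -!natz natr_sum; apply: eq_bigr => k _; rewrite natz.
have -> : \sum_(k < l'.+2) (x (k.+1%:R : Res))%:Z = (row_size x)%:Z.
  rewrite -(row_size_shift x) -/(row_size (fun j => x (j + 1))) h -!natz natr_sum.
  by apply: eq_bigr => k _; rewrite natz -natr1.
by [].
Qed.

Lemma lindley_fix : exists c : row, forall j, c (j + 1) = (c j + y j - x (j + 1)%R)%N.
Proof.
(* One turn sends [c0] to the maximum of [c0] and [c0 + drift], which is [c0] because the drift of a
   full turn is not positive. *)
pose c0 := lindley 0 l'.+2.
have c0E : lindley c0 l'.+2 = c0.
  by apply/eqP; rewrite -eqz_nat lindleyE -/c0; have := drift_le0; lia.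
exists (fun j => lindley c0 j) => j.
have [lt|] := ltnP j l'.+1.
  have -> : nat_of_ord (j + 1) = j.+1 by rewrite /= [(1 %% _)%N]modn_small // addn1 modn_small.
  by rewrite /= natr_Zp -natr1 natr_Zp.
move=> ge; have ej : (j : nat) = l'.+1 by apply/eqP; rewrite eqn_leq ge andbT -ltnS.
have e0 : j + 1 = 0 by apply/val_inj; rewrite /= [(1 %% _)%N]modn_small // ej addn1 modnn.
have st n : lindley c0 n.+1 = (lindley c0 n + y n%:R - x n.+1%:R)%N by [].
rewrite {1}e0 [LHS](_ : _ = lindley c0 l'.+2); last by rewrite c0E.
have ejR : l'.+1%:R = j by rewrite -ej natr_Zp.
by rewrite st -(natr1 l'.+1) ejR ej.
Qed.

Lemma Rmatrix_ex : exists x' y', Rmatrix y x x' y'.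
Proof.
have [c hc] := lindley_fix.
pose U : row := fun j => (x j - (y (j - 1)%R + c (j - 1)%R))%N.
have hU j : U (j + 1) = (x (j + 1)%R - (y j + c j))%N by rewrite /U addrK.
exists (add_rows y U), (fun j => x j - U j)%N, U, c; split=> // j.
- by rewrite /U; lia.
- by rewrite hU hc; lia.
- by rewrite -[j](subrK 1) hc hU; lia.
Qed.

End Existence.

(** Either side makes the carrier monotone around the cycle, hence constant; then [y'] is [y]
    rotated by one residue. *)
Lemma Rmatrix_vac r m (q : row) y x x' y' : Rmatrix y x x' y' ->
  (y = delta r m /\ x = add_rows (delta (r + 1) m) q) <->
  (y' = delta (r + 1) m /\ x' = add_rows (delta r m) q).
Proof.
move=> [U [c [hx hx' hc hU]]].
have nr : (r + 1 == r) = false by rewrite succ_neq.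
have reduce : (forall j, y' (j + 1) = y j) ->
  (y = delta r m /\ x = add_rows (delta (r + 1) m) q) <->
  (y' = delta (r + 1) m /\ x' = add_rows (delta r m) q).
  move=> e; have h : y = delta r m <-> y' = delta (r + 1) m.
    split=> h; apply/funext => j.
      by rewrite -[j](subrK 1) e h /delta (inj_eq (addIr 1)).
    by rewrite -e h /delta (inj_eq (addIr 1)).
  split=> -[e1 e2]; [have e3 := h.1 e1|have e3 := h.2 e1]; split=> //; apply/funext => j.
    by have := hx j; have := hx' j; rewrite e1 e2 e3 /add_rows; lia.
  by have := hx j; have := hx' j; rewrite e1 e2 e3 /add_rows; lia.
split=> h; apply/reduce => // {reduce} j.
  have hd : forall j, (c (j + 1)%R <= c j)%N.
    move: h => [ey ex] {}j; have := hc j; rewrite ey /delta.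
    case: eqP => [->|_]; last by lia.
    have := hx (r + 1); rewrite ex /add_rows /delta eqxx; have := hU (r + 1).
    by lia.
  by have := hc j; rewrite (cycle_const hd) => /addnI.
have hd : forall j, (c j <= c (j + 1)%R)%N.
  move: h => [ey ex] {}j; have := hc j; rewrite ey /delta (inj_eq (addIr 1)).
  case: eqP => [->|_]; last by lia.
  have := hx' r; rewrite ex /add_rows /delta eqxx; have := hU r.
  by lia.
by have := hc j; rewrite (cycle_const_inc hd) => /addnI.
Qed.

Fixpoint Rmatrix_past x ys x' ys' : Prop :=
  match ys, ys' with
  | [::], [::] => x' = x
  | y :: ys0, y' :: ys0' => exists2 x1, Rmatrix_past x ys0 x1 ys0' & Rmatrix y x1 x' y'
  | _, _ => False
  end.

Lemma Rmatrix_past_size x ys x' ys' : Rmatrix_past x ys x' ys' ->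
  row_size x' = row_size x /\ map row_size ys' = map row_size ys.
Proof.
elim: ys x' ys' => [|y ys IH] x' [|y' ys'] //=; first by move->.
by move=> [x1 /IH[<- ->] /Rmatrix_size[-> ->]].
Qed.

Lemma Rmatrix_past_ex x ys : all (fun y => row_size y <= row_size x)%N ys ->
  exists x' ys', Rmatrix_past x ys x' ys'.
Proof.
elim: ys => [_|y ys IH /=/andP[h /IH[x1 [ys' hc]]]]; first by exists x, [::].
have [e _] := Rmatrix_past_size hc.
have [|x' [y' hR]] := @Rmatrix_ex x1 y; first by rewrite e.
by exists x', (y' :: ys'), x1.
Qed.

Lemma Rmatrix_past_raise i a x ys x' ys' : Rmatrix_past x ys x' ys' ->
  row_phi i (list_phi i a ys) x = list_phi i (row_phi i a x') ys' /\
  Rmatrix_past (row_raise i (list_phi i a ys) x) (raise i a ys) (row_raise i a x') (raise i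
      (row_phi i a x') ys').
Proof.
elim: ys a x' ys' => [|y ys IH] a x' [|y' ys'] //=; first by move->.
move=> [x1 /(IH (row_phi i a y))[e1 h1] /(Rmatrix_raise i a)[e2 h2]].
rewrite e1 e2; split=> //; exists (row_raise i (row_phi i a y) x1) => //.
by rewrite -e2.
Qed.

Fixpoint ground r m n : seq row :=
  if n is n'.+1 then delta r m :: ground (r + 1) m n' else [::].

Lemma ground_rcons r m n : ground r m n.+1 = rcons (ground r m n) (delta (r + n%:R) m).
Proof.
elim: n r => [|n IH] r; first by rewrite /= addr0.
have -> : ground r m n.+2 = delta r m :: ground (r + 1) m n.+1 by [].
by rewrite IH /= -addrA -natr1 [1 + _]addrC.
Qed.

Lemma size_ground r m n : size (ground r m n) = n.
Proof. by elim: n r => //= n IH r; rewrite IH. Qed.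

Lemma Rmatrix_past_vac r m n (q : row) x ys x' ys' : Rmatrix_past x ys x' ys' -> size ys = n ->
  (ys = ground r m n /\ x = add_rows (delta (r + n%:R) m) q) <->
  (ys' = ground (r + 1) m n /\ x' = add_rows (delta r m) q).
Proof.
elim: ys n r x' ys' => [|y ys IH] n r x' [|y' ys'] //=.
  by move=> -> <- /=; rewrite addr0.
move=> [x1 hc hR] <- /=.
have := IH _ (r + 1) _ _ hc erefl; rewrite -addrA -natr1 [1 + _]addrC.
have := Rmatrix_vac r m q hR.
move=> h1 h2; split.
  move=> [[ey eys] ex]; have [e1 e2] := h2.1 (conj eys ex).
  by have [e3 e4] := h1.1 (conj ey e2); rewrite e3 e1 e4.
move=> [[ey eys] ex]; have [e1 e2] := h1.2 (conj ey ex).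
by have [e3 e4] := h2.2 (conj eys e2); rewrite e1 e3 e4 size_ground.
Qed.

(* The order 1 < 2 < ... < l on letters; the residue 0 stands for the letter l. *)
Definition letter_of (j : Res) : nat := if j == 0 then l'.+2 else j.

Definition row_split m x y z := [/\ x = add_rows y z, row_size y = m &
  forall j j', (0 < z j)%N -> (0 < y j')%N -> (letter_of j' <= letter_of j)%N].

Lemma letter_of_inj : injective letter_of.
Proof.
move=> j j'; rewrite /letter_of; have := ltn_ord j; have := ltn_ord j'.
have [->|h] := eqVneq j 0; have [->|h'] := eqVneq j' 0 => //.
- by move=> ? ? e; lia.
- by move=> ? ? e; lia.
by move=> _ _ e; apply/val_inj.
Qed.

Lemma letter_ofS i : i != 0 -> letter_of (i + 1) = (letter_of i).+1.
Proof.
move=> i0; rewrite /letter_of (negbTE i0).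
have [e|h] := eqVneq (i + 1) 0.
  have ei : i = -1 by rewrite -[i](addrK 1) e add0r.
  rewrite ei /= modn_small ?subn1 //= modn_small //.
have := ltn_ord i; rewrite leq_eqVlt => /orP[/eqP e|lt].
  case/eqP: h; apply/val_inj; rewrite /= [(1 %% _)%N]modn_small //.
  by rewrite addn1 e modnn.
by rewrite /= [(1 %% _)%N]modn_small // addn1 modn_small.
Qed.

Lemma letter_of1 j : (letter_of 1%R <= letter_of j)%N.
Proof.
rewrite /letter_of; case: (j =P 0) => [_|j0] //=; rewrite modn_small //.
by rewrite lt0n; apply/eqP => e; apply: j0; apply/val_inj.
Qed.

Lemma letter_of0 j : (letter_of j <= letter_of 0%R)%N.
Proof. by rewrite /letter_of eqxx; case: ifP => // _; apply: ltnW. Qed.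

Lemma row_split_raise i m g x y z : row_split m x y z ->
  row_phi i (level m i + g) x = row_phi i (level m i + row_phi i g z) y /\
  row_split m (row_raise i (level m i + g) x) (row_raise i (level m i + row_phi i g z) y)
      (row_raise i g z).
Proof.
move=> [-> sy h].
have ni : (i + 1 == i) = false by rewrite succ_neq.
have [i0|i0] := eqVneq i 0.
  have y1 := row_size_ge y 1; rewrite sy in y1.
  have hz : (0 < z 1%R)%N -> y 1 = m /\ forall j, j != 1 -> y j = 0%N.
    move=> z1; have h0 j : j != 1 -> y j = 0%N.
      move=> j1; apply/eqP; rewrite -leqn0 leqNgt; apply/negP => yj.
      have := h _ _ z1 yj; have := letter_of1 j => a1 a2.
      by case/eqP: j1; apply: letter_of_inj; apply/eqP; rewrite eqn_leq a1 a2.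
    split=> //; rewrite -sy /row_size (bigD1 1) //= big1 ?addn0 //.
  have z1 := hz; rewrite /level i0 eqxx /row_phi /add_rows add0r; split.
    have [e|e] := posnP (z 1); first by lia.
    by have [e1 e2] := hz e; have := e2 0 isT; lia.
  have hup : row_raise 0 (m + (z 0%R + (g - z 1%R)))%N y = y.
    apply/funext => j; rewrite /row_raise add0r.
    have [->|_] := eqVneq j 0; first by lia.
    by have [->|_] := eqVneq j 1; lia.
  rewrite hup; split=> //.
    apply/funext => j; rewrite /row_raise /add_rows add0r.
    have [->|_] := eqVneq j 0.
      have [e|e] := posnP (z 1); first by lia.
      by have [e1 e2] := hz e; lia.
    have [->|_] := eqVneq j 1 => //.
    have [e|e] := posnP (z 1); first by lia.
    by have [e1 e2] := hz e; lia.
  move=> j j'; rewrite /row_raise add0r.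
  have [->|_] := eqVneq j 0; first by rewrite letter_of0.
  have [->|_] := eqVneq j 1; last exact: h.
  by move=> h1; apply: h; lia.
rewrite /level (negbTE i0) !add0n.
have hi : z i = 0%N \/ y (i + 1) = 0%N.
  case: (posnP (z i)) => [->|zi]; first by left.
  case: (posnP (y (i + 1))) => [->|yi]; first by right.
  by have := h _ _ zi yi; rewrite letter_ofS // ltnn.
rewrite /row_phi /add_rows; split; first by lia.
split.
- apply/funext => j; rewrite /row_raise /add_rows /=; have [_|_] := eqVneq j i; first by lia.
  by have [_|_] := eqVneq j (i + 1); lia.
- by rewrite row_size_row_raise.
move=> j j'; rewrite /row_raise.
have lS := letter_ofS i0.
have hj := h (i + 1) j'; have hj' := h j (i + 1); have hi' := h i j'; have hii := h j i.
have hjj := h j j'; have hiS := h (i + 1) (i + 1).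
have h01 := h (i + 1) i.
have nj : j' != i -> j' != i + 1 -> (0 < y j' -> 0 < z (i + 1)%R ->
    letter_of j' <= letter_of i)%N.
  move=> n1 n2 a1 a2; have := h _ _ a2 a1; rewrite lS leq_eqVlt => /orP[/eqP e|//].
  by case/eqP: n2; apply: letter_of_inj; rewrite e lS.
move: nj.
have [->|_] := eqVneq j i; have [->|_] := eqVneq j' i => //=.
- have [->|_] := eqVneq j' (i + 1); first by lia.
  by move=> /(_ isT isT); lia.
- by have [->|_] := eqVneq j (i + 1); lia.
- have [->|_] := eqVneq j (i + 1); have [->|_] := eqVneq j' (i + 1); lia.
Qed.

Lemma row_split_ex m k x : row_size x = (m + k)%N -> exists y z, row_split m x y z.
Proof.
elim: m k => [|m IH] k sx.
  exists (fun=> 0%N), x; split=> //; rewrite /row_size; exact: big1.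
have [y [z [ex sy h]]] := IH k.+1 (etrans sx (addSnnS _ _)).
have sz : (0 < row_size z)%N.
  by have := congr1 row_size ex; rewrite row_sizeD sy; lia.
have [j0 hj0] : exists j, (0 < z j)%N.
  apply/existsP; rewrite -[[exists _, _]]negbK negb_exists; apply/negP => /forallP h0.
  by move: sz; rewrite /row_size big1 // => j _; have := h0 j; lia.
case: (@arg_minnP _ j0 (fun j => 0 < z j)%N letter_of hj0) => j1 zj1 min1.
exists (add_rows y (delta j1 1)), (fun j => z j - delta j1 1 j)%N; split.
- apply/funext => j; rewrite ex /add_rows /delta; case: eqP => [->|]; lia.
- by rewrite row_sizeD row_size_delta sy addn1.
move=> j j' zj; have zj' : (0 < z j)%N by lia.
rewrite /add_rows /delta; have [->|_] := eqVneq j' j1; first by move=> _; apply: min1.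
by rewrite addn0; apply: h.
Qed.

Lemma row_split_delta m (q : row) x y z : row_split m x y z ->
  x = add_rows (delta 1 m) q -> y = delta 1 m /\ z = q.
Proof.
move=> [-> sy h] e.
have ey : y = delta 1 m.
  have h0 j : j != 1 -> y j = 0%N.
    move=> j1; apply/eqP; rewrite -leqn0 leqNgt; apply/negP => yj.
    have lt1 : (y 1%R < m)%N.
      by rewrite -sy /row_size (bigD1 1 isT) (bigD1 j j1) -addn1 leq_add2l addn_gt0 yj.
    have z1 : (0 < z 1%R)%N.
      by have := congr1 (fun f => f 1) e; rewrite /add_rows /delta eqxx; lia.
    have := h _ _ z1 yj; have := letter_of1 j => a1 a2.
    by case/eqP: j1; apply: letter_of_inj; apply/eqP; rewrite eqn_leq a1 a2.
  apply/funext => j; rewrite /delta; case: eqP => [->|/eqP /h0 //].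
  by rewrite -sy /row_size (bigD1 1) //= big1 ?addn0.
split=> //; apply/funext => j; have := congr1 (fun f => f j) e.
by rewrite ey /add_rows => /addnI.
Qed.

(* [level_split m zt et zs]: each row of [zt] is moved to the head through the
   rows of size [m] already split off and then gives up its [m] smallest letters
   to [et], the rest going to [zs]. *)
Inductive level_split m : seq row -> seq row -> seq row -> Prop :=
| level_split_nil : level_split m [::] [::] [::]
| level_split_rcons zt0 x et0 zs0 x' et' y z of level_split m zt0 et0 zs0 & Rmatrix_past x
    et0 x' et' &
    row_split m x' y z : level_split m (rcons zt0 x) (y :: et') (rcons zs0 z).

Lemma level_split_size m zt et zs : level_split m zt et zs ->
  [/\ size et = size zt, size zs = size zt & all (fun y => row_size y == m) et].
Proof.
elim=> {zt et zs} // zt0 x et0 z0 x' et' y z _ [s1 s2 s3] hc [_ sy _].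
have [_ e] := Rmatrix_past_size hc; rewrite !size_rcons s2 -s1 /= sy eqxx.
rewrite -(size_map row_size et') e size_map; split=> //.
by move: s3; rewrite -!(all_map row_size (pred1 m)) e.
Qed.

Lemma level_split_raise i g m zt et zs : level_split m zt et zs ->
  list_phi i (level m i + g) zt = list_phi i (level m i + list_phi i g zs) et /\
  level_split m (raise i (level m i + g) zt) (raise i (level m i + list_phi i g zs) et)
      (raise i g zs).
Proof.
elim=> {zt et zs} [|zt0 x et0 z0 x' et' y z _ [e0 h0] hc hs].
  by split=> //; exact: level_split_nil.
rewrite -!cats1 !raise_cat !list_phi_cat /= e0.
have [e1 h1] := Rmatrix_past_raise i (level m i + list_phi i g z0) hc.
have [e2 h2] := row_split_raise i (list_phi i g z0) hs.
rewrite e1 e2; split=> //; rewrite !cats1; apply: level_split_rcons h0 _ h2.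
by rewrite -e2.
Qed.

Lemma level_split_ex m k zt : all (fun x => row_size x == m + k)%N zt ->
    exists et zs, level_split m zt et zs.
Proof.
elim/last_ind: zt => [_|zt x IH]; first by exists [::], [::]; exact: level_split_nil.
rewrite all_rcons => /andP[/eqP sx /IH[et [zs h]]].
have [_ _ se] := level_split_size h.
have [|x' [et' hc]] := @Rmatrix_past_ex x et.
  by apply: sub_all se => y /eqP ->; rewrite sx leq_addr.
have [sx' _] := Rmatrix_past_size hc; rewrite sx in sx'.
have [y [z hs]] := row_split_ex sx'.
by exists (y :: et'), (rcons zs z); apply: level_split_rcons h hc hs.
Qed.

Lemma delta_add r m k : delta r (m + k) = add_rows (delta r m) (delta r k).
Proof. by apply/funext => j; rewrite /add_rows /delta; case: ifP. Qed.

(** On its way through the ground state the last row has [m] of its letters turned into 1, the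
    smallest letter, and these are the ones given up; the other [k] stay as they are. *)
Lemma level_split_vac m k zt et zs : level_split m zt et zs ->
  zt = ground 1 (m + k) (size zt) <->
  et = ground 1 m (size zt) /\ zs = ground 1 k (size zt).
Proof.
move=> h; elim: h => {zt et zs} [|zt0 x et0 z0 x' et' y z h0 [IH1 IH2] hc hs] //.
have [se sz _] := level_split_size h0.
have [cv1 cv2] := Rmatrix_past_vac 1 m (delta (1 + (size zt0)%:R) k) hc se.
rewrite size_rcons (ground_rcons _ (m + k)) (ground_rcons _ k); split.
  move=> /rcons_inj[/IH1[e1 e2]]; rewrite delta_add => ex.
  have [e3 e4] := cv1 (conj e1 ex).
  have [e5 e6] := row_split_delta hs e4.
  by rewrite e2 e3 e5 e6.
move=> [[ey eet]] /rcons_inj[ez0 ez].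
have ex' : x' = add_rows (delta 1 m) (delta (1 + (size zt0)%:R) k).
  by case: hs => -> _ _; rewrite ey ez.
have [e1 e2] := cv2 (conj eet ex').
by rewrite e2 -delta_add -IH2.
Qed.

End Exchange.

(** * Stability of the set of katabolizable elements *)

Section Stability.
Variables (l' : nat).
Local Notation Res := 'I_l'.+2.
Local Notation row := (row l').
Implicit Types (i j r s : Res) (x y z : row) (S T t : seq row) (v w : seq Res).
Implicit Types (X : seq row -> Prop) (m k N : nat).

Definition shift_row r x : row := fun j => x (j - r).

Lemma shift_rowK r : cancel (shift_row r) (shift_row (- r)).
Proof. by move=> x; apply/funext => j; rewrite /shift_row opprK addrK. Qed.

Lemma shift_rowVK r : cancel (shift_row (- r)) (shift_row r).
Proof. by move=> x; apply/funext => j; rewrite /shift_row opprK subrK. Qed.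

Lemma shift_row_add r s x : shift_row r (shift_row s x) = shift_row (r + s) x.
Proof. by apply/funext => j; rewrite /shift_row -addrA -opprD. Qed.

Lemma shift_row_delta r s m : shift_row r (delta s m) = delta (s + r) m.
Proof. by apply/funext => j; rewrite /shift_row /delta subr_eq. Qed.

Lemma raise_shift_row r i a t : raise (i + r) a (map (shift_row r) t) = map (shift_row r)
    (raise i a t).
Proof.
elim: t a => //= x t IH a.
have e : row_phi (i + r) a (shift_row r x) = row_phi i a x by rewrite /row_phi /shift_row
    addrK addrAC addrK.
rewrite e IH; congr (_ :: _); apply/funext => j.
rewrite /row_raise /shift_row addrK addrAC addrK !subr_eq [i + 1 + r]addrAC.
by [].
Qed.

Lemma row_size_raise i a t : map (@row_size l') (raise i a t) = map (@row_size l') t.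
Proof. by elim: t a => //= x t IH a; rewrite IH row_size_row_raise. Qed.

Lemma row_size_run k v t : map (@row_size l') (run k v t) = map (@row_size l') t.
Proof. by elim: v t => //= i v IH t; rewrite IH row_size_raise. Qed.

Lemma row_size_ground r m n : map (@row_size l') (ground r m n) = nseq n m.
Proof. by elim: n r => //= n IH r; rewrite row_size_delta IH. Qed.

Definition rows_of_size m N S := all (fun x => row_size x == m) (take N S).

Lemma rows_of_sizeE m N S S' : map (@row_size l') S = map (@row_size l') S' ->
    rows_of_size m N S = rows_of_size m N S'.
Proof.
move=> e; rewrite /rows_of_size -!(all_map (@row_size l') (pred1 m)).
by rewrite !map_take e.
Qed.

(** A vacuum of residue [r] entering the row [delta (r + 1) k] raises nothing and leaves as a vacuum
    of residue [r + 1]. *)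
Lemma raise_ground i r k n :
  let a := if i == r then k else 0%N in
  raise i a (ground (r + 1) k n) = ground (r + 1) k n /\
  list_phi i a (ground (r + 1) k n) = (if i == r + n%:R then k else 0%N).
Proof.
elim: n r => [|n IH] r /=; first by rewrite addr0.
have e1 : row_phi i (if i == r then k else 0%N) (delta (r + 1) k) = (if i == r + 1 then k
    else 0%N).
  by rewrite /row_phi /delta (inj_eq (addIr 1)) subnn addn0.
have := IH (r + 1); rewrite /= e1 => -[-> ->]; split.
  congr (_ :: _); apply/funext => j;
      rewrite /row_raise /delta (inj_eq (addIr 1)) subnn addn0 minnn.
  have [->//|_] := eqVneq j i.
  by have [->|//] := eqVneq j (i + 1); rewrite (inj_eq (addIr 1)).
by rewrite -addrA -natr1 [1 + _]addrC.
Qed.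

Lemma highest_ground k n : highest k (ground 1 k n : seq row).
Proof. by move=> i; have [] := raise_ground i 0 k n; rewrite add0r. Qed.

Lemma list_phi_ground i k n : list_phi i (level k i) (ground 1 k n : seq row) = (if i ==
    n%:R then k else 0%N).
Proof. by have [_] := raise_ground i 0 k n; rewrite !add0r. Qed.

(* [1 ... N] are the residues of the ground state, so the tail is rotated back
   by [N] before it is tested. *)
Definition accepts X m N S v :=
  exists2 t, run m v S = ground 1 m N ++ t & X (map (shift_row (- N%:R)) t).

(** The second clause handles the letters that are not kept when levels are split: there the rows of
    size [m] meet a positive surplus [a]. *)
Definition stable X m := forall N S, rows_of_size m N S ->
  (forall v v', height_le v v' -> accepts X m N S v -> accepts X m N S v') /\
  (forall i a v, (0 < a)%N -> accepts X m N (raise i (level m i + a) S) v <->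
      accepts X m N S v).

Lemma accepts_rows_of_size X m N S v : accepts X m N S v -> rows_of_size m N S.
Proof.
move=> [t e _]; rewrite -(rows_of_sizeE _ _ (row_size_run m v S)) e /rows_of_size
    take_size_cat ?size_ground //.
by rewrite -(all_map (@row_size l') (pred1 m)) row_size_ground all_nseq /= eqxx orbT.
Qed.

Lemma stable_nil : stable (fun t => t = [::]) 0.
Proof.
have key N S v : rows_of_size 0 N S -> accepts (fun t => t = [::]) 0 N S v <-> size S = N.
  move=> sS; split.
    move=> [t e /(congr1 size)]; rewrite size_map /= => /size0nil t0.
    by have := congr1 size e; rewrite size_run t0 cats0 size_ground.
  move=> sz; exists [::] => //; rewrite cats0.
  have : map (@row_size l') (run 0 v S) = nseq N 0%N.
    rewrite row_size_run; move: sS; rewrite /rows_of_size take_oversize ?sz //.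
    rewrite -(all_map (@row_size l') (pred1 0%N)) => /all_pred1P ->.
    by rewrite size_map sz.
  rewrite -(row_size_ground 1); move: (run 0 v S) (1 : Res).
  elim: N {sS sz} => [|n IH] [|x z] r //= [e1 /IH ->]; congr (_ :: _).
  apply/funext => j; have := row_size_ge x j; rewrite e1 row_size_delta /delta.
  by case: ifP => _; lia.
move=> N S sS; split=> [v v' _|i a v _].
  by move/(key _ _ _ sS)/(key _ _ v' sS).
have sS' : rows_of_size 0 N (raise i (level 0 i + a) S) by rewrite (rows_of_sizeE _ _
    (row_size_raise _ _ _)).
by rewrite (key _ _ _ sS) (key _ _ _ sS') size_raise.
Qed.

Lemma levelD m k i : level (m + k) i = (level m i + level k i)%N.
Proof. by rewrite /level; case: ifP. Qed.

Section LevelRaise.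
Variables (X : seq row -> Prop) (m k : nat).
Hypothesis GX : stable X m.

(* A run at level [m + k] is a run at level [k] on [zs] together with a run at
   level [m] on [et] along the kept letters; at the other letters the raising on
   [et] is partial and does not matter by stability. *)
Lemma accepts_level_split zt et zs t v : level_split m zt et zs ->
  accepts X (m + k) (size zt) (zt ++ t) v <->
  run k v zs = ground 1 k (size zt) /\ accepts X m (size zt) (et ++ t) (kept k v zs).
Proof.
elim: v zt et zs t => [|i v IH] zt et zs t hE /=; have [se ss ae] := level_split_size hE.
  split.
    move=> [t' /= /eqP]; rewrite eqseq_cat ?size_ground // => /andP[/eqP e1 /eqP <-] hX.
    have [e2 e3] := (level_split_vac k hE).1 e1; split=> //.
    by exists t; rewrite //= e2.
  move=> [e1 [t' /= /eqP]]; rewrite eqseq_cat ?size_ground // => /andP[/eqP e2 /eqP <-] hX.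
  by exists t; rewrite //= -((level_split_vac k hE).2 (conj e2 e1)).
have [e1 h1] := level_split_raise i (level k i) hE.
have stp w S m' : accepts X m' (size zt) S (i :: w) <->
    accepts X m' (size zt) (raise i (level m' i) S) w by [].
rewrite stp raise_cat levelD e1 -[size zt](size_raise i (level m i + level k i)) (IH _ _ _
    _ h1).
rewrite -raise_cat size_raise.
have sz : rows_of_size m (size zt) (et ++ t) by rewrite /rows_of_size -se take_size_cat.
case: posnP => [-> /=|p].
  by rewrite addn0.
by have [_ h2] := GX sz; rewrite (h2 _ _ _ p).
Qed.

Lemma stable_raise_level : stable X (m + k).
Proof.
move=> N S sS.
have [NS|NS] := leqP N (size S); last first.
  have no S' v : size S' = size S -> ~ accepts X (m + k) N S' v.
    move=> eS [t /(congr1 size)]; rewrite size_run size_cat size_ground => e _.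
    by move: NS; rewrite -eS e; lia.
  split=> [v v' _ /(no _ _ erefl)//|i a v _].
  by split=> [/(no _ _ (size_raise _ _ _))|/(no _ _ erefl)].
have [et [zs hE]] := level_split_ex sS.
have [se ss ae] := level_split_size hE.
set zt := take N S in hE se ss; set t := drop N S.
have sN : size zt = N by rewrite size_takel.
have eS : S = zt ++ t by rewrite cat_take_drop.
have sz : rows_of_size m N (et ++ t) by rewrite /rows_of_size -sN -se take_size_cat.
have [h1 h2] := GX sz.
have key v : accepts X (m + k) N S v <->
    run k v zs = ground 1 k N /\ accepts X m N (et ++ t) (kept k v zs).
  by rewrite eS -sN; exact: accepts_level_split.
split=> [v v' vv|i a v a0].
  rewrite !key => -[e hA].
  have hv : highest k (run k v zs) by rewrite e; exact: highest_ground.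
  split; first by rewrite (run_height_le hv vv).
  by apply: h1 hA; exact: kept_height_le.
have [e1 hE1] := level_split_raise i (level k i + a) hE.
have key1 : accepts X (m + k) N (raise i (level (m + k) i + a) S) v <->
   run k v (raise i (level k i + a) zs) = ground 1 k N /\
   accepts X m N (raise i (level m i + list_phi i (level k i + a) zs) (et ++ t)) (kept k v
       (raise i (level k i + a) zs)).
  rewrite eS levelD -addnA raise_cat e1 -sN -{1 2 3}(size_raise i (level m i + (level k i +
      a)) zt).
  by rewrite (accepts_level_split _ _ hE1) -raise_cat size_raise.
rewrite key1 key.
have runE : run k v (raise i (level k i + a) zs) = ground 1 k N <-> run k v zs = ground 1 k N.
  split=> e.
    by rewrite -e run_raise_highest //; right; rewrite e; exact: highest_ground.
  by rewrite -e run_raise_highest //; left; rewrite e; exact: highest_ground.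
rewrite runE; split=> -[e hA]; split=> //; move: hA.
  have hv : highest k (run k v zs) by rewrite e; exact: highest_ground.
  have := kept_raise_highest i a0 hv => /= -[_].
  (* If nothing leaves [zs], the raising on [et] is a full letter and joins the kept word; otherwise
     it is partial and stability at level [m] removes it. *)
  case: posnP => [p|p] le.
    by rewrite p addn0 => hA; apply: (h1 _ _ le).
  by rewrite h2 // => hA; apply: (h1 _ _ le).
have hv : highest k (run k v zs) by rewrite e; exact: highest_ground.
have := kept_raise_highest i a0 hv => /= -[le _].
move: le; case: posnP => [p|p] le.
  by rewrite p addn0 => hA; apply: (h1 _ _ le).
by rewrite h2 // => hA; apply: (h1 _ _ le).
Qed.

End LevelRaise.

Definition classical v := all (fun i => i != 0) v.

Lemma run_shift_row r w t : run 0 (map (fun i =>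
    i + r) w) (map (shift_row r) t) = map (shift_row r) (run 0 w t).
Proof.
elim: w t => //= i w IH t; rewrite -IH; congr run.
by rewrite /level !if_same raise_shift_row.
Qed.

Lemma run_classical m w t : classical w -> run m w t = run 0 w t.
Proof.
elim: w t => //= i w IH t /andP[/negbTE i0 cw].
by rewrite IH // /level i0.
Qed.

(** The ground state lets letters through only at residue [N], which the letters [i + N] with [i]
    nonzero avoid; the tail thus sees level 0. *)
Lemma run_vacs_cat m N w t : classical w ->
  run m (map (fun i => i + N%:R) w) (ground 1 m N ++ t) =
  ground 1 m N ++ run 0 (map (fun i => i + N%:R) w) t.
Proof.
elim: w t => //= i w IH t /andP[i0 cw].
rewrite raise_cat highest_ground list_phi_ground -subr_eq0 addrK (negbTE i0) IH //.
by rewrite /level if_same.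
Qed.

Definition kat_step X m w (b : seq row) : Prop :=
  exists2 t, run 0 w b = delta 1 m :: t & X (map (shift_row (- 1)) t).

Section Step.
Variables (X : seq row -> Prop) (m : nat) (w : seq Res).
Hypotheses (GX : stable X m) (cw : classical w).

(** Acting by [w] on the tail rotated by [- N] is acting by [w] shifted by [N] on the list itself,
    and the row then required to be [1^m] is the next row of the ground state. A katabolism step is
    thus absorbed as one more frozen row. *)
Lemma accepts_step N S v : accepts (kat_step X m w) m N S v <->
  run m v (take N S) = ground 1 m N /\ accepts X m N.+1 S (v ++ map (fun i => i + N%:R) w).
Proof.
have map_shr t : t = map (shift_row N%:R) (map (shift_row (- N%:R)) t).
  by rewrite -map_comp map_id_in // => x _ /=; rewrite shift_rowVK.
split.
  move=> [t e [t' e' hX]]; split.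
    by rewrite take_run e take_size_cat // size_ground.
  exists (map (shift_row N%:R) t').
    rewrite ground_rcons cat_rcons run_cat e run_vacs_cat // {1}[t]map_shr run_shift_row e' /=.
    by rewrite shift_row_delta.
  rewrite -map_comp; move: hX; congr X; apply: eq_map => x /=.
  by rewrite shift_row_add -natr1 opprD addrAC addNr add0r.
rewrite take_run => -[e [t e' hX]].
have eS : run m v S = ground 1 m N ++ drop N (run m v S) by rewrite -{1}e cat_take_drop.
exists (drop N (run m v S)) => //.
exists (map (shift_row (- N%:R)) t).
  move: e'; rewrite run_cat eS run_vacs_cat // ground_rcons cat_rcons.
  move/(congr1 (drop N)); rewrite !drop_size_cat ?size_ground //.
  rewrite {1}[drop N _]map_shr run_shift_row => /(congr1 (map (shift_row (- N%:R)))).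
  rewrite -map_comp map_id_in => [->|x _ /=]; last by rewrite shift_rowK.
  by rewrite /= shift_row_delta addrK.
rewrite -map_comp; move: hX; congr X; apply: eq_map => x /=.
by rewrite shift_row_add -natr1 opprD addrC.
Qed.

Lemma stable_step : stable (kat_step X m w) m.
Proof.
move=> N S sS; split=> [v v' vv|i a v a0].
  rewrite !accepts_step => -[e hA].
  have hv : highest m (run m v (take N S)) by rewrite e; exact: highest_ground.
  rewrite (run_height_le hv vv); split=> //.
  by have [h1 _] := GX (accepts_rows_of_size hA); apply: h1 hA; exact: height_le_catr.
have runE : run m v (raise i (level m i + a) (take N S)) = ground 1 m N <->
            run m v (take N S) = ground 1 m N.
  split=> e.
    by rewrite -e run_raise_highest //; right; rewrite e; exact: highest_ground.
  by rewrite -e run_raise_highest //; left; rewrite e; exact: highest_ground.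
rewrite !accepts_step -take_raise runE; split=> -[e hA]; split=> //.
  have sz : rows_of_size m N.+1 S by rewrite -(rows_of_sizeE _ _ (row_size_raise i (level m
      i + a) S)); exact: accepts_rows_of_size hA.
  by have [_ h2] := GX sz; rewrite -(h2 i a).
by have [_ h2] := GX (accepts_rows_of_size hA); rewrite h2.
Qed.

(** A classical word runs alike at every level, so [kat_step] is acceptance with a single frozen row
    at level [m]. *)
Lemma kat_step_height_le w' b : classical w' -> height_le w w' -> kat_step X m w b ->
    kat_step X m w' b.
Proof.
have aux u : classical u -> kat_step X m u b <-> accepts X m 1 b u.
  move=> cu; split=> -[t e hX]; exists t => //.
    by rewrite run_classical.
  by rewrite -(run_classical m).
move=> cw' ww; rewrite !aux // => hA.
by have [h1 _] := GX (accepts_rows_of_size hA); exact: h1 hA.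
Qed.

End Step.

Fixpoint kat_set (mu : seq nat) (ws : seq (seq Res)) : seq row -> Prop :=
  match mu, ws with
  | m :: mu', w :: ws' => kat_step (kat_set mu' ws') m w
  | _, _ => fun b => b = [::]
  end.

(** By induction the set for the tail is stable at the level [n] of the next part; the step keeps
    this level, and passing from [n] to [m] requires [n <= m]. *)
Lemma stable_kat_set m mu ws : path geq m mu -> size mu = size ws -> all classical ws ->
  stable (kat_set mu ws) m.
Proof.
elim: mu m ws => [|n mu IH] m [|w ws] //=.
  by move=> _ _ _; exact: (@stable_raise_level _ 0 m stable_nil).
move=> /andP[nm pm] [sz] /andP[cw cws].
rewrite -(subnKC nm); apply: stable_raise_level; apply: stable_step => //.
exact: IH.
Qed.

End Stability.

(** * Tabloids and crystal elements as lists of rows *)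

Section TabloidRows.
Variables (l' : nat).
Local Notation l := l'.+2.
Local Notation Res := 'I_l.
Local Notation row := (row l').
Implicit Types (T : tabloid l) (J i : Res) (mu : seq nat).

(* The residue [J] stands for the letter [(J - 1).+1] of [1, l], which is row
   [J - 1] of a tabloid when rows are counted from 0. *)
Definition entry_row T (s : nat) : row := fun J => count_mem s (tnth T (J - 1)).
Definition entry_rows (p : nat) T : seq row := map (entry_row T) (iota 1 p).
Definition gen_residue (j : nat) : Res := j.+1%:R.

Lemma val_natr_ord (j : nat) : (j < l)%N -> nat_of_ord (j%:R : Res) = j.
Proof. by move=> jl; apply: etrans (@val_Zp_nat l isT j) _; rewrite modn_small. Qed.

Lemma val_pred_gen_residue (j : nat) J : (j < l)%N ->
    (nat_of_ord (J - 1) == j) = (J == gen_residue j).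
Proof.
move=> jl; rewrite /gen_residue -natr1 -subr_eq; apply/eqP/eqP => [<-|->].
  by rewrite natr_Zp.
exact: val_natr_ord.
Qed.

Lemma P_row_entry_row j T : is_tabloid T -> (j.+1 < l)%N ->
  (forall J, sorted leq (tnth (P_row j T) J)) /\
  forall s J, entry_row (P_row j T) s J =
    if J == gen_residue j then top_count (entry_row T^~ (gen_residue j)) (entry_row T^~
        (gen_residue j + 1)) s
    else if J == gen_residue j + 1 then bottom_count (entry_row T^~ (gen_residue j))
        (entry_row T^~ (gen_residue j + 1)) s
    else entry_row T s J.
Proof.
move=> /allP tT jl; have jl' := ltnW jl.
have nthT (k : nat) : (k < l)%N -> nth [::] T k = tnth T (gen_residue k - 1).
  move=> kl; rewrite /gen_residue -natr1 addrK (tnth_nth [::]) val_natr_ord //.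
have sT J : sorted leq (tnth T J) by have /andP[] := tT _ (mem_tnth J T).
have gen_residueS : gen_residue j.+1 = gen_residue j + 1 by rewrite /gen_residue -natr1.
rewrite /P_row !nthT // gen_residueS.
have [h0 h1 h2] := insertion_tableauP (sT (gen_residue j + 1 - 1)) (sT (gen_residue j - 1)).
split=> [J|s J]; first by rewrite tnth_mktuple; do 2?case: ifP.
rewrite /entry_row tnth_mktuple !val_pred_gen_residue // gen_residueS.
by have [e1 e2] := h2 s; case: ifP => // _; case: ifP.
Qed.

(** [pending] satisfies the recursion of [row_phi]: the letters waiting to bump in Schensted
    insertion are the unmatched letters of the crystal rule. *)
Lemma raise_rows (F : nat -> row) i s n :
  let c := fun s => F s i in let d := fun s => F s (i + 1) in
  raise i (pending c d s) (map F (iota s n)) =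
  map (fun s J => if J == i then top_count c d s else if J == i + 1 then bottom_count c d s
      else F s J)
    (iota s n).
Proof.
move=> c d; elim: n s => //= n IH s; rewrite -[row_phi _ _ _]/(pending c d s.+1) IH.
by [].
Qed.

Lemma is_tabloidP T : is_tabloid T <->
  (forall J, sorted leq (tnth T J)) /\ (forall J, entry_row T 0 J = 0%N).
Proof.
have pos r : all (leq 1) r = (count_mem 0%N r == 0%N).
  by elim: r => //= -[|x] r ->.
split.
  move=> /allP h; split=> J; first by have /andP[] := h _ (mem_tnth J T).
  by have /andP[_] := h _ (mem_tnth (J - 1) T); rewrite pos => /eqP.
move=> [h1 h2]; apply/allP => r /tnthP[J ->]; rewrite h1 pos /=.
by have := h2 (J + 1); rewrite /entry_row addrK => ->.
Qed.

Lemma P_row_entry_rows p j T : is_tabloid T -> (j.+1 < l)%N ->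
  entry_rows p (P_row j T) = raise (gen_residue j) 0 (entry_rows p T).
Proof.
move=> tT jl; have [_ h] := P_row_entry_row tT jl.
have [_ h0] := (is_tabloidP T).1 tT.
(* Rows start at entry 1, and a tabloid has no entry 0, so nothing is pending there. *)
have -> : 0%N = pending (entry_row T^~ (gen_residue j)) (entry_row T^~ (gen_residue j + 1)) 1.
  by rewrite /= !h0.
rewrite raise_rows; apply: eq_map => s; apply/funext => J; exact: h.
Qed.

Lemma count_entry_row T s : count_mem s (flatten T) = row_size (entry_row T s).
Proof.
rewrite count_mem_flatten_tuple -row_size_shift; apply: eq_bigr => J _.
by rewrite /entry_row addrK.
Qed.

Lemma P_row_Tabloids mu j T : (j.+1 < l)%N -> Tabloids l mu T -> Tabloids l mu (P_row j T).
Proof.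
move=> jl [tT cT]; have [h1 h2] := P_row_entry_row tT jl.
have [_ h0] := (is_tabloidP T).1 tT; split.
  apply/is_tabloidP; split=> // J; rewrite h2 /top_count /bottom_count !h0.
  by do 2?case: ifP.
move=> s s0; rewrite -(cT s s0) !count_entry_row.
have := congr1 (fun z => nth 0%N (map (@row_size l') z) s.-1) (P_row_entry_rows s tT jl).
rewrite row_size_raise /entry_rows -!map_comp !(nth_map 0%N) ?size_iota ?prednK //.
by rewrite nth_iota ?prednK //= add1n prednK.
Qed.

End TabloidRows.

(** * Lowering operators on lists of rows *)

Section Lowering.
Variables (l' : nat).
Local Notation Res := 'I_l'.+2.
Local Notation row := (row l').
Implicit Types (i J : Res) (x : row) (t T : seq row).

Definition row_lower i x : row := fun J =>
  if J == i then (x i).-1 else if J == i + 1 then (x (i + 1)).+1 else x J.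
Fixpoint list_eps i t : nat :=
  if t is x :: t' then (x (i + 1)%R + (list_eps i t' - x i))%N else 0.
Fixpoint lowerable i t : bool :=
  if t is x :: t' then (list_eps i t' < x i)%N || lowerable i t' else false.
Fixpoint lower i t : seq row :=
  if t is x :: t' then
    if (list_eps i t' < x i)%N then row_lower i x :: t' else x :: lower i t'
  else [::].

Lemma raise_id i a T : (list_eps i T <= a)%N -> raise i a T = T.
Proof.
elim: T a => //= x t IH a h; rewrite IH; last by rewrite /row_phi; lia.
congr (_ :: _); apply/funext => J; rewrite /row_raise.
have [->|_] := eqVneq J i; first by lia.
by have [->|//] := eqVneq J (i + 1); lia.
Qed.

Lemma list_eps_raise i a T : list_eps i (raise i a T) = minn a (list_eps i T).
Proof.
elim: T a => [|x t IH] a /=; first by rewrite minn0.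
by rewrite IH /row_raise /row_phi eqxx succ_neq eqxx; lia.
Qed.

(** Raisings with growing protection interpolate, one lowering at a time, between the top of the
    string ([a = 0]) and the list itself ([a = list_eps i T], by [raise_id]). *)
Lemma lower_raise i a T : (a < list_eps i T)%N ->
  lowerable i (raise i a T) /\ lower i (raise i a T) = raise i a.+1 T.
Proof.
elim: T a => [|x t IH] a //= h.
rewrite list_eps_raise.
have xi : row_raise i a x i = (x i + (x (i + 1)%R - a))%N by rewrite /row_raise eqxx.
rewrite xi; case: (leqP (x (i + 1)) a) => xa.
  have lt : (row_phi i a x < list_eps i t)%N by rewrite /row_phi; lia.
  have [h1 h2] := IH _ lt; rewrite h1 orbT; split=> //.
  have -> : (minn (row_phi i a x) (list_eps i t) < x i + (x (i + 1)%R - a))%N = false.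
    by rewrite /row_phi in lt *; lia.
  rewrite h2; congr (_ :: raise _ _ _); last by rewrite /row_phi; lia.
  apply/funext => J; rewrite /row_raise; have [_|_] := eqVneq J i; first by lia.
  by have [_|//] := eqVneq J (i + 1); lia.
have -> : (minn (row_phi i a x) (list_eps i t) < x i + (x (i + 1)%R - a))%N.
  by rewrite /row_phi; lia.
split=> //; congr (_ :: raise _ _ _); last by rewrite /row_phi; lia.
apply/funext => J; rewrite /row_lower /row_raise eqxx succ_neq eqxx.
have [_|_] := eqVneq J i; first by lia.
by have [_|//] := eqVneq J (i + 1); lia.
Qed.

Lemma raise_lower i a T : lowerable i T -> (a <= list_eps i T)%N ->
    raise i a (lower i T) = raise i a T.
Proof.
elim: T a => [|x t IH] a //= d h.
case: ltnP d => /= lt; last first.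
  by move=> d; rewrite /= IH //; rewrite /row_phi; lia.
move=> _; have ni := succ_neq i.
rewrite ![raise i _ t]raise_id; last 2 first.
- by rewrite /row_phi; lia.
- by rewrite /row_phi /row_lower eqxx ni eqxx; lia.
congr (_ :: _); apply/funext => J; rewrite /row_lower /row_raise eqxx ni eqxx.
have [_|_] := eqVneq J i; first by lia.
by have [_|//] := eqVneq J (i + 1); lia.
Qed.

End Lowering.

(** * The bracket rule as a recursion on the factors *)

Section Brackets.
Variables (l i : nat).
Implicit Types (v : seq nat) (b : crystal_elt) (s : seq (bool * nat)).

Fixpoint open_brackets n s : nat :=
  match s with
  | [::] => n
  | (true, _) :: s' => open_brackets n.+1 s'
  | (false, _) :: s' => open_brackets n.-1 s'
  end.

Lemma open_brackets_cat n s s' : open_brackets n (s ++ s') = open_brackets (open_brackets n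
    s) s'.
Proof. by elim: s n => // -[[] j] s IH n /=. Qed.

Lemma unmatched_cat n s s' : unmatched n (s ++ s') = unmatched n s ++ unmatched
    (open_brackets n s) s'.
Proof. by elim: s n => // -[[] j] s IH [|n] //=; rewrite IH. Qed.

Lemma unmatched_close n a j s :
  unmatched n (nseq a (false, j) ++ s) = nseq (a - n)%N j ++ unmatched (n - a)%N s.
Proof. by elim: a n => [|a IH] [|n] //=; rewrite IH ?subn0 ?sub0n ?subSS. Qed.

Lemma open_brackets_close n a j : open_brackets n (nseq a (false, j)) = (n - a)%N.
Proof. by elim: a n => [|a IH] n /=; rewrite ?subn0 // IH; lia. Qed.

Lemma unmatched_open n a j : unmatched n (nseq a (true, j)) = [::].
Proof. by elim: a n => //= a IH n. Qed.

Lemma open_brackets_open n a j : open_brackets n (nseq a (true, j)) = (n + a)%N.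
Proof. by elim: a n => [|a IH] n /=; rewrite ?addn0 // IH addnS. Qed.

Fixpoint brackets_from k b : seq (bool * nat) :=
  if b is v :: b' then
    brackets_from k.+1 b' ++ nseq (phi l i v) (false, k) ++ nseq (epsilon i v) (true, k)
  else [::].

Lemma brackets_from_flatten k b : flatten [seq nseq (phi l i (nth [::] b (j - k)%N))
    (false, j) ++
    nseq (epsilon i (nth [::] b (j - k)%N)) (true,
        j) | j <- rev (iota k (size b))] = brackets_from k b.
Proof.
elim: b k => //= v b IH k.
rewrite rev_cons map_rcons flatten_rcons subnn -IH; congr (flatten _ ++ _).
apply/eq_in_map => j; rewrite mem_rev mem_iota => /andP[kj _].
by rewrite -(subnSK kj).
Qed.

Lemma bracketsE b : brackets l i b = brackets_from 0 b.
Proof.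
rewrite -brackets_from_flatten; congr flatten; apply: eq_map => j; by rewrite subn0.
Qed.

Fixpoint eps_rec b : nat :=
  if b is v :: b' then (epsilon i v + (eps_rec b' - phi l i v))%N else 0.

Lemma open_brackets_from k b : open_brackets 0 (brackets_from k b) = eps_rec b.
Proof.
elim: b k => //= v b IH k; rewrite !open_brackets_cat IH open_brackets_close
    open_brackets_open.
by rewrite addnC.
Qed.

(** The list starts with the rightmost factor, so the rightmost unmatched closing bracket is sought
    at the head first; [eps_rec b'] counts the opening brackets still pending on its left. *)
Fixpoint f_rec b : option crystal_elt :=
  if b is v :: b' then
    if (eps_rec b' < phi l i v)%N then omap (cons^~ b') (f_row l i v) else omap (cons v)
        (f_rec b')
  else None.

Lemma f_op_rec b : f_op l i b = f_rec b.
Proof.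
have key k : f_rec b = if rev (unmatched 0 (brackets_from k b)) is j :: _ then
    omap (set_nth [::] b (j - k)) (f_row l i (nth [::] b (j - k))) else None.
  (* The lower bound [k] is carried along because the subtraction [j - k] is truncated. *)
  suff [] : all (leq k) (unmatched 0 (brackets_from k b)) /\
    f_rec b = if rev (unmatched 0 (brackets_from k b)) is j :: _ then
    omap (set_nth [::] b (j - k)) (f_row l i (nth [::] b (j - k))) else None by [].
  elim: b k => //= v b IH k; have [h1 h2] := IH k.+1.
  rewrite unmatched_cat open_brackets_from unmatched_close unmatched_open cats0.
  split.
    rewrite all_cat all_nseq leqnn orbT andbT.
    by apply: sub_all h1 => j; exact: ltnW.
  rewrite rev_cat; case: ltnP => lt.
    have : (0 < phi l i v - eps_rec b)%N by lia.
    case: (phi l i v - eps_rec b)%N => // n _.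
    by rewrite rev_nseq /= subnn.
  rewrite (_ : (phi l i v - eps_rec b = 0)%N) /=; last by lia.
  move: h1; rewrite h2 -all_rev; case: (rev _) => //= j s /andP[kj _].
  by rewrite -(subnSK kj) /=; case: f_row.
by rewrite /f_op bracketsE (key 0); case: (rev _) => // j s; rewrite subn0.
Qed.

End Brackets.

(** * Crystal elements as lists of rows, and the DARK crystal as [kat_set] *)

Section CrystalRows.
Variables (l' : nat).
Local Notation l := l'.+2.
Local Notation Res := 'I_l.
Local Notation row := (row l').
Implicit Types (J : Res) (v : seq nat) (b : crystal_elt) (mu : seq nat).

Definition letter_row v : row := fun J => count_mem ((J - 1)%R : Res).+1 v.
Definition B1_word v := sorted leq v && all (fun a => 1 <= a <= l)%N v.
Local Notation rows b := (map letter_row b).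

Lemma BmuP mu b : Bmu l mu b <-> all B1_word b /\ map size b = mu.
Proof.
split.
  move=> [sb h]; split.
    by apply/(all_nthP [::]) => j; rewrite sb => /h /and3P[_ s1 s2]; apply/andP.
  apply: (@eq_from_nth _ 0%N); rewrite size_map // => j jb.
  by rewrite (nth_map [::]) //; rewrite sb in jb; have /and3P[/eqP] := h _ jb.
move=> [/(all_nthP [::]) h <-]; split; first by rewrite size_map.
move=> j; rewrite size_map => jb; rewrite (nth_map [::]) // /is_B1 eqxx.
exact: h.
Qed.

Lemma letter_row_gen_residue v (a : nat) : (a < l)%N ->
    letter_row v (gen_residue l' a) = count_mem a.+1 v.
Proof. by move=> al; rewrite /letter_row /gen_residue -natr1 addrK val_natr_ord. Qed.

Lemma gen_residueS (a : nat) : gen_residue l' a + 1 = gen_residue l' a.+1.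
Proof. by rewrite /gen_residue natr1. Qed.

Lemma gen_residue_surj J : J = gen_residue l' (J - 1)%R.
Proof. by rewrite /gen_residue -natr1 natr_Zp subrK. Qed.

Lemma count_B1_word v a : B1_word v -> ~~ (1 <= a <= l)%N -> count_mem a v = 0%N.
Proof. by move=> /andP[_ /allP h] na; apply/count_memPn; apply: contra na => /h. Qed.

Lemma letter_row_inj v v' : B1_word v -> B1_word v' -> letter_row v = letter_row v' -> v = v'.
Proof.
move=> ov ov' e; have /andP[sv _] := ov; have /andP[sv' _] := ov'.
apply: sorted_count_eq => // a.
case: (boolP (1 <= a <= l)%N) => [/andP[a1 al]|na]; last by rewrite !count_B1_word.
case: a a1 al => // a _ al; rewrite -!letter_row_gen_residue //; by rewrite e.
Qed.

Lemma rows_inj b b' : all B1_word b -> all B1_word b' -> rows b = rows b' -> b = b'.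
Proof.
elim: b b' => [|v b IH] [|v' b'] //= /andP[ov ob] /andP[ov' ob'] [e1 e2].
by rewrite (letter_row_inj ov ov' e1) (IH b').
Qed.

Lemma row_size_letter_row v : B1_word v -> row_size (letter_row v) = size v.
Proof.
move=> /andP[_ h]; rewrite -(size_count_iota h) -row_size_shift.
by apply: eq_bigr => J _; rewrite /letter_row addrK.
Qed.

Definition row_word (x : row) : seq nat :=
    flatten [seq nseq (x (gen_residue l' a.-1)) a | a <- iota 1 l].

Lemma B1_word_row_word x : B1_word (row_word x).
Proof.
apply/andP; split; first exact: sorted_nseq_flatten.
apply/allP => a /flatten_mapP[j]; rewrite mem_iota add1n ltnS => jl /nseqP[-> _].
exact: jl.
Qed.

Lemma row_wordK x : letter_row (row_word x) = x.
Proof.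
apply/funext => J; rewrite /letter_row /row_word.
rewrite (count_nseq_flatten (fun a => x (gen_residue l' a.-1))) ?iota_uniq //.
have -> : ((J - 1)%R : Res).+1 \in iota 1 l by rewrite mem_iota; apply/andP; split=> //;
    rewrite add1n ltnS; exact: (ltn_ord (J - 1)%R).
by rewrite mul1n -gen_residue_surj.
Qed.

Lemma f_rowP (i : nat) v : (i.+1 < l)%N -> B1_word v ->
    (0 < letter_row v (gen_residue l' i))%N ->
  exists v', [/\ f_row l i.+1 v = Some v', B1_word v', size v' = size v &
    letter_row v' = row_lower (gen_residue l' i) (letter_row v)].
Proof.
move=> il /andP[sv av]; rewrite letter_row_gen_residue; last exact: ltnW.
rewrite -has_count has_pred1 => iv; rewrite /f_row /= iv.
have iv' : i.+1 \in rev v by rewrite mem_rev.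
(* [p1] holds, reversed, the letters to the right of the rightmost [i.+1]; they all exceed it, so
   the changed word stays sorted. *)
pose p1 := take (index i.+1 (rev v)) (rev v); pose p2 := drop (index i.+1 (rev v)).+1 (rev v).
have ilt : (index i.+1 (rev v) < size (rev v))%N by rewrite index_mem.
have erv : rev v = p1 ++ i.+1 :: p2.
  by rewrite -{1}(cat_take_drop (index i.+1 (rev v)) (rev v)) (drop_nth 0%N ilt) nth_index.
have nip1 : i.+1 \notin p1.
  by rewrite /p1 in_take_leq ?ltnn // ltnW.
have eset : set_nth 0%N (rev v) (index i.+1 (rev v)) i.+2 = p1 ++ i.+2 :: p2.
  by rewrite set_nthE ilt.
have ev : v = rev p2 ++ i.+1 :: rev p1.
  by rewrite -[v]revK erv rev_cat rev_cons cat_rcons.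
rewrite eset rev_cat rev_cons cat_rcons.
exists (rev p2 ++ i.+2 :: rev p1); split=> //.
- apply/andP; split; last first.
    move: av; rewrite ev !all_cat /= => /andP[-> /andP[_ ->]]; rewrite andbT /=.
    exact: il.
  move: sv; rewrite ev !sorted_catP => /and3P[-> s2 h].
  have hp1 a : a \in rev p1 -> (i.+2 <= a)%N.
    move=> ap; move: s2; rewrite /= (path_sortedE leq_trans) => /andP[/allP /(_ _ ap)].
    rewrite leq_eqVlt => /orP[/eqP e|//] _.
    by move: nip1; rewrite e -mem_rev ap.
  apply/and3P; split=> //.
    rewrite /= (path_sortedE leq_trans); apply/andP; split; first by apply/allP => a /hp1.
    exact: path_sorted s2.
  apply/allP => a /(allP h) /= /andP[ai h']; rewrite h' andbT; exact: ltnW.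
- by rewrite ev !size_cat.
apply/funext => J; rewrite /row_lower; have [->|nJ] := eqVneq J (gen_residue l' i).
  rewrite !letter_row_gen_residue ?(ltnW il) // ev !count_cat /= eqxx (gtn_eqF (ltnSn i.+1)).
  by rewrite add0n add1n addnS.
have [->|nJ'] := eqVneq J (gen_residue l' i + 1).
  rewrite gen_residueS !letter_row_gen_residue // ev !count_cat /= eqxx (ltn_eqF (ltnSn i.+1)).
  by rewrite add0n add1n addnS.
rewrite /letter_row ev !count_cat /=.
have -> : (i.+1 == ((J - 1)%R : Res).+1) = false.
  by rewrite eqSS eq_sym val_pred_gen_residue ?(negbTE nJ) // ltnW.
have -> // : (i.+2 == ((J - 1)%R : Res).+1) = false.
by rewrite eqSS eq_sym val_pred_gen_residue // -gen_residueS (negbTE nJ').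
Qed.

Lemma eps_rec_rows (i : nat) b : (i.+1 < l)%N ->
    eps_rec l i.+1 b = list_eps (gen_residue l' i) (rows b).
Proof.
move=> il; elim: b => //= v b ->.
by rewrite gen_residueS !letter_row_gen_residue // ltnW.
Qed.

Lemma f_op_rows (i : nat) b : (i.+1 < l)%N -> all B1_word b ->
  if lowerable (gen_residue l' i) (rows b) then
    exists b', [/\ f_op l i.+1 b = Some b', all B1_word b', map size b' = map size b &
      rows b' = lower (gen_residue l' i) (rows b)]
  else f_op l i.+1 b = None.
Proof.
move=> il; rewrite f_op_rec; elim: b => //= v b IH /andP[ov ob].
rewrite eps_rec_rows //.
have -> : phi l i.+1 v = letter_row v (gen_residue l' i) by rewrite letter_row_gen_residue
    // ltnW.
case: ltnP => [lt|ge] /=.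
  have [|v' [-> ov' sv' cv']] := f_rowP il ov; first by apply: leq_ltn_trans lt.
  by exists (v' :: b); rewrite /= ov' sv' cv'.
move: (IH ob); case: ifP => [_ [b' [-> ob' sb' cb']]|_ -> //].
by exists (v :: b'); rewrite /= ov sb' cb'.
Qed.

Lemma iter_f_op (i : nat) mu b b' n : (i.+1 < l)%N -> Bmu l mu b ->
  iter n (obind (f_op l i.+1)) (Some b) = Some b' ->
  Bmu l mu b' /\ raise (gen_residue l' i) 0 (rows b') = raise (gen_residue l' i) 0 (rows b).
Proof.
move=> il Bb; elim: n b' => [|n IH] b' /=; first by case=> <-.
case e : (iter n _ _) => [b1|] //= e'; have [/BmuP[ob1 sb1] <-] := IH _ e.
have := f_op_rows il ob1; case: ifP => fd; last by rewrite e'.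
rewrite e' => -[b2 [[<-] ob2 sb2 cb2]]; split.
  by apply/BmuP; rewrite sb2.
by rewrite cb2 raise_lower.
Qed.

Lemma iter_f_op_raise (i : nat) mu b : (i.+1 < l)%N -> Bmu l mu b ->
  exists b0 n, [/\ Bmu l mu b0, rows b0 = raise (gen_residue l' i) 0 (rows b) &
    iter n (obind (f_op l i.+1)) (Some b0) = Some b].
Proof.
move=> il /BmuP[ob sb]; pose b0 := map row_word (raise (gen_residue l' i) 0 (rows b)).
have cb0 : rows b0 = raise (gen_residue l' i) 0 (rows b).
  by rewrite (mapK row_wordK).
have ob0 : all B1_word b0 by apply/allP => v /mapP[x _ ->]; exact: B1_word_row_word.
have sizes b1 : all B1_word b1 -> map size b1 = map (@row_size l') (rows b1).
  by move=> /allP o1; rewrite -map_comp; apply/eq_in_map => v /o1 /row_size_letter_row /= ->.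
have Bb0 : Bmu l mu b0.
  by apply/BmuP; split=> //; rewrite sizes // cb0 row_size_raise -sizes.
have key n : (n <= list_eps (gen_residue l' i) (rows b))%N -> exists bn,
    [/\ iter n (obind (f_op l i.+1)) (Some b0) = Some bn, all B1_word bn &
     rows bn = raise (gen_residue l' i) n (rows b)].
  elim: n => [_|n IH lt]; first by exists b0.
  have [bn [en on cn]] := IH (ltnW lt); rewrite /= en /=.
  have [fd fe] := lower_raise lt.
  have := f_op_rows il on; rewrite cn fd => -[b' [e' o' _ c']].
  by exists b'; rewrite c'.
have [bn [en on cn]] := key _ (leqnn _).
exists b0, (list_eps (gen_residue l' i) (rows b)); split=> //.
by rewrite en (rows_inj on ob) // cn raise_id.
Qed.

Lemma tau_B1_word v : B1_word v ->
    B1_word (sort leq [seq if a == l then 1%N else a.+1 | a <- v]).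
Proof.
move=> /andP[_ /allP h]; apply/andP; split; first by apply: sort_sorted; exact: leq_total.
rewrite all_sort; apply/allP => a /mapP[a' /h /andP[_ al] ->].
by case: eqP => //= ne; move: al; rewrite leq_eqVlt => /orP[/eqP|].
Qed.

Lemma tau_letter_row v : B1_word v ->
  letter_row (sort leq [seq if a == l then 1%N else a.+1 | a <- v]) = shift_row 1
      (letter_row v).
Proof.
move=> /andP[_ /allP h]; apply/funext => J; rewrite /shift_row /letter_row.
rewrite (permP (permEl (perm_sort _ _))) count_map; apply: eq_in_count => a /h /andP[a1 al].
set q : Res := J - 1.
change (((if a == l then 1%N else a.+1) == (nat_of_ord q).+1) =
        (a == (nat_of_ord (q - 1)%R).+1)).
(* Residue [q = 0] stands here for the letter 1, which rotation produces from the letter [l]. *)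
have [q0|q0] := eqVneq q 0.
  have -> : nat_of_ord (q - 1) = l'.+1.
    by rewrite q0 add0r /= [(1 %% _)%N]modn_small // subn1 modn_small.
  by rewrite q0; case: (a =P l) => // na; apply/negP => /eqP /= [] e; rewrite e in a1.
have qv : (0 < nat_of_ord q)%N by rewrite lt0n; apply: contra q0 => /eqP e; apply/eqP/val_inj.
have -> : nat_of_ord (q - 1) = (nat_of_ord q).-1.
  have e : q - 1 = (nat_of_ord q).-1%:R.
    by rewrite -{1}[q]natr_Zp -{1}(prednK qv) -natr1 addrK.
  rewrite e val_natr_ord //; have := ltn_ord q; lia.
rewrite prednK //; have := ltn_ord q.
by case: (a =P l) => [->|_]; lia.
Qed.

Lemma tau_rows b : all B1_word b -> rows (tau l b) = map (shift_row 1) (rows b).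
Proof.
move=> /allP ob; rewrite /tau -!map_comp; apply/eq_in_map => v /ob ov /=.
exact: tau_letter_row.
Qed.

Lemma tau_Bmu mu b : Bmu l mu b -> Bmu l mu (tau l b).
Proof.
move=> /BmuP[ob sb]; apply/BmuP; split.
  by apply/allP => v /mapP[v' v'b ->]; apply: tau_B1_word; exact: (allP ob).
rewrite -sb /tau -map_comp; apply: eq_map => v /=.
by rewrite size_sort size_map.
Qed.

Definition residues (u : hecke_word l) : seq Res := map (fun i : 'I_l'.+1 =>
    gen_residue l' i) u.

Lemma gen_residue_neq0 (i : nat) : (i.+1 < l)%N -> gen_residue l' i != 0.
Proof. by move=> il; apply/eqP => /(congr1 val) /=; rewrite val_natr_ord. Qed.

Lemma classical_residues u : classical (residues u).
Proof. by apply/allP => J /mapP[i _ ->]; apply: gen_residue_neq0; rewrite ltnS. Qed.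

Lemma B1_word_nseq1 m : B1_word (nseq m 1%N).
Proof.
apply/andP; split; last by rewrite all_nseq orbT.
by case: m => //= m; elim: m => //= m ->.
Qed.

Lemma letter_row_nseq1 m : letter_row (nseq m 1%N) = delta 1 m.
Proof.
apply/funext => J; rewrite /letter_row count_nseq /delta /= eqSS eq_sym
    val_pred_gen_residue //.
by rewrite /gen_residue; case: ifP => _; rewrite ?mul1n.
Qed.

(** Membership is tested by raising: an element is reached by lowerings from the top of its string,
    and all elements of a string have the same top. That the top satisfies the test whenever some
    element does is where monotonicity enters. *)
Lemma darkP mu (ws : seq (hecke l)) b : sorted geq mu -> size mu = size ws ->
  dark mu ws b <-> Bmu l mu b /\ kat_set mu [seq residues (repr w) | w <- ws] (rows b).
Proof.
elim: mu ws b => [|m mu IH] [|w ws] b //=.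
  move=> _ _; split; first by move=> ->.
  by move=> [/BmuP[_]]; case: b.
move=> pm [sz]; set W := [seq residues (repr w0) | w0 <- ws].
have sm : sorted geq mu by exact: path_sorted pm.
have GX : stable (kat_set mu W) m.
  apply: stable_kat_set => //; first by rewrite size_map.
  by apply/allP => u /mapP[w' _ ->]; exact: classical_residues.
rewrite /Fset_hecke; elim: (repr w) b => [|i u IHu] b /=.
  split.
    move=> [b1 [b0 /(IH _ _ sm sz)[Bb0 Kb0] <-] <-].
    have Bt := tau_Bmu Bb0; split.
      apply/BmuP; move/BmuP: Bt => [ot st] /=.
      by rewrite B1_word_nseq1 ot st size_nseq.
    exists (map (shift_row 1) (rows b0)); first by rewrite /= letter_row_nseq1 tau_rows //;
        case/BmuP: Bb0.
    by rewrite (mapK (shift_rowK 1)).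
  move=> [/BmuP[]]; case: b => [|v b] //= /andP[ov ob] [sv sb] [t [cv <-] hK].
  exists b; last by rewrite (letter_row_inj ov (B1_word_nseq1 m)) // letter_row_nseq1.
  pose b0 := map row_word (map (shift_row (- 1)) (rows b)).
  have cb0 : rows b0 = map (shift_row (- 1)) (rows b).
    by rewrite (mapK row_wordK).
  have ob0 : all B1_word b0 by apply/allP => v' /mapP[x _ ->]; exact: B1_word_row_word.
  have Bb0 : Bmu l mu b0.
    apply/BmuP; split=> //; rewrite -sb -!map_comp; apply/eq_in_map => v' v'b /=.
    rewrite -row_size_letter_row ?B1_word_row_word // row_wordK -(row_size_letter_row (allP
        ob _ v'b)) -row_size_shift /shift_row.
    rewrite -[RHS]row_size_shift -[RHS]/(row_size (fun j =>
        letter_row v' (j + 1))) -[RHS]row_size_shift.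
    by apply: eq_bigr => J _; rewrite opprK.
  exists b0; first by apply/(IH _ _ sm sz); rewrite cb0.
  have /BmuP[ot _] := tau_Bmu Bb0.
  apply: rows_inj => //; by rewrite tau_rows // cb0 (mapK (shift_rowVK 1)).
have il : (i.+1 < l)%N by rewrite ltnS.
split.
  move=> [b1 /IHu[Bb1 st] [n it]].
  have [Bb er] := iter_f_op il Bb1 it; split=> //.
  (* [b1] passes the test for [u], hence for the larger word [i :: u], whose first raising does not
     distinguish [b1] from [b]. *)
  have := kat_step_height_le GX (classical_residues u) (classical_residues (i :: u))
      (height_le_consr _ _) st.
  by move=> [t e hX]; exists t => //; move: e; rewrite /= /level if_same er.
move=> [Bb [t e hX]].
have [b0 [n [Bb0 cb0 it]]] := iter_f_op_raise il Bb.
exists b0; last by exists n.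
apply/IHu; split=> //; exists t => //; rewrite cb0.
by move: e; rewrite /= /level if_same.
Qed.

End CrystalRows.

(** * Katabolizability as [kat_set], and independence of the chosen words *)

Section Katabolism.
Variables (l' : nat).
Local Notation l := l'.+2.
Local Notation Res := 'I_l.
Implicit Types (T : tabloid l) (J : Res) (mu : seq nat) (u v : hecke_word l).

Lemma gen_residue_eq (a b : nat) : (a <= b)%N -> (b < a + l)%N ->
    gen_residue l' a = gen_residue l' b -> a = b.
Proof.
move=> ab bl e; have : ((b - a)%N%:R : Res) = 0.
  by rewrite natrB //; apply/eqP; rewrite subr_eq0; apply/eqP/(addIr 1); rewrite !natr1.
move/(congr1 val); rewrite /= val_natr_ord; lia.
Qed.

Lemma gen_residue_comm (a b : nat) : (a.+1 < b)%N -> (b.+1 < l)%N ->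
  gen_residue l' b != gen_residue l' a + 1 /\ gen_residue l' a != gen_residue l' b + 1.
Proof.
move=> ab bl; rewrite !gen_residueS; split; apply/eqP => e.
  by have : a.+1 = b by [apply: gen_residue_eq (esym e); lia]; lia.
by have : a = b.+1 by [apply: gen_residue_eq e; lia]; lia.
Qed.

Lemma gen_residue_braid (a : nat) : (a.+2 < l)%N ->
    gen_residue l' a != gen_residue l' a.+1 + 1.
Proof.
move=> al; rewrite gen_residueS; apply/eqP => e.
by have : a = a.+2 by [apply: gen_residue_eq e; lia]; lia.
Qed.

Lemma hecke_relation_acts u v c : hecke_relation u v -> Maya c ->
  acts (residues u) c = acts (residues v) c.
Proof.
case=> [i|i j ij|i j ij] mc /=; first exact: act_idem.
  have [h1 h2] := gen_residue_comm ij (ltn_ord j : (j.+1 < l)%N).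
  exact: act_comm.
have jl : (j.+1 < l)%N := ltn_ord j.
by rewrite ij in jl *; apply: act_braid => //; [rewrite gen_residueS|exact: gen_residue_braid].
Qed.

Lemma hecke_cong_height_le u v : hecke_cong u v ->
    height_le (residues u) (residues v) /\ height_le (residues v) (residues u).
Proof.
elim=> {u v} [u v r|u|u v _ [h1 h2]|u v x _ [h1 h2] _ [h3 h4]|u u' v v' _ [h1 h2] _ [h3 h4]].
- by split=> a b; rewrite (hecke_relation_acts r) //; exact: Maya_vac_height.
- by split; exact: height_le_refl.
- by [].
- by split; [exact: height_le_trans h1 h3|exact: height_le_trans h4 h2].
- by rewrite /residues !map_cat; split; exact: height_le_cat.
Qed.

Lemma kat_set_height_le (g g' : hecke l -> seq Res) mu ws b :
  (forall w, height_le (g w) (g' w)) -> (forall w, classical (g w)) ->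
  (forall w, classical (g' w)) -> sorted geq mu -> size mu = size ws ->
  kat_set mu (map g ws) b -> kat_set mu (map g' ws) b.
Proof.
move=> gg cg cg'; elim: mu ws b => [|m mu IH] [|w ws] b //= pm [sz] st.
have GX : stable (kat_set mu (map g ws)) m.
  apply: stable_kat_set => //; first by rewrite size_map.
  by apply/allP => u /mapP[w' _ ->].
have [t e hX] := kat_step_height_le GX (cg w) (cg' w) (gg w) st.
by exists t => //; apply: IH => //; exact: path_sorted pm.
Qed.

(** [foldr] applies the last letter first and [run] the first one, whence the reversal. *)
Lemma P_word_entry_rows mu p u T : Tabloids l mu T ->
  let U := foldr (fun i : 'I_l.-1 => @P_row l i) T u in
  Tabloids l mu U /\ entry_rows p U = run 0 (residues (rev u)) (entry_rows p T).
Proof.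
move=> TT; elim: u => //= i u [TU eU].
have il : (i.+1 < l)%N by rewrite ltnS.
split; first exact: P_row_Tabloids.
rewrite P_row_entry_rows //; last by case: TU.
by rewrite eU rev_cons /residues map_rcons -cats1 run_cat /= /level if_same.
Qed.

Lemma ones_in_row0 m mu T : Tabloids l (m :: mu) T ->
  [forall i : 'I_l, (1%N \in tnth T i) ==> (i == 0%N :> nat)] <-> entry_row T 1 = delta 1 m.
Proof.
move=> [_ cT]; have := cT 1%N isT; rewrite /= count_entry_row => sT; split.
  move=> /forallP h; have h0 J : J != 1 -> entry_row T 1 J = 0%N.
    move=> J1; apply/count_memPn; apply/negP => i1.
    have := h (J - 1); rewrite i1 /= => /eqP e; case/eqP: J1.
    by rewrite -[J](subrK 1); rewrite (_ : J - 1 = 0) ?add0r //; apply/val_inj.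
  apply/funext => J; rewrite /delta; case: eqP => [->|/eqP /h0 //].
  by rewrite -sT /row_size (bigD1 1) //= big1 ?addn0.
move=> e; apply/forallP => i; apply/implyP => i1.
have := congr1 (fun x => x (i + 1)) e; rewrite /entry_row /delta addrK.
case: eqP => [e1 _|_ /count_memPn]; last by rewrite i1.
by rewrite (_ : i = 0) //; apply: (addIr 1); rewrite e1 add0r.
Qed.

Lemma ordS_add1 J : ordS J = J + 1.
Proof. by apply/val_inj; rewrite /= [(1 %% _)%N]modn_small // addn1. Qed.

Lemma kat_entry_rows p T : entry_rows p (kat T) = map (shift_row (- 1)) (map (entry_row T)
    (iota 2 p)).
Proof.
rewrite /entry_rows -map_comp (iotaDl 1 1) -map_comp; apply/eq_in_map => s.
rewrite mem_iota => /andP[s0 _]; apply/funext => J /=.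
rewrite /entry_row kat_row count_kat_row gtn_eqF // /shift_row opprK addrK.
by rewrite ordS_add1 subrK.
Qed.

Lemma katabolizableP mu ws T : Tabloids l mu T -> size mu = size ws ->
  katabolizable ws T <->
  kat_set mu [seq residues (rev (repr (hecke_rev w))) | w <- ws] (entry_rows (size mu) T).
Proof.
elim: mu ws T => [|m mu IH] [|w ws] T TT //=.
  move=> _; split=> // _; apply/allP => r rT; case: TT => /allP tT cT.
  apply/eqP; have /andP[_ /allP pr] := tT _ rT.
  case: r rT pr => // a r rT pr; have a0 := pr a (mem_head _ _).
  have := cT a a0; rewrite nth_nil => /eqP; rewrite -leqn0 leqNgt -has_count.
  by move/hasP; case; exists a => //=; apply/flattenP; exists (a :: r) => //; exact: mem_head.
move=> [sz]; have [] := P_word_entry_rows (size mu).+1 (repr (hecke_rev w)) TT.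
rewrite -[foldr _ _ _]/(P_hecke (hecke_rev w) T) => TU eU.
have KU := kat_Tabloids TU.
split.
  move=> /andP[/(ones_in_row0 TU) e /(IH _ _ KU sz)]; rewrite kat_entry_rows => hK.
  by exists (map (entry_row (P_hecke (hecke_rev w) T)) (iota 2 (size mu))) => //;
      rewrite -eU /entry_rows /= e.
move=> [t]; rewrite -eU /entry_rows /= => -[e <-] hK.
apply/andP; split; first exact/(ones_in_row0 TU).
by apply/(IH _ _ KU sz); rewrite kat_entry_rows.
Qed.

Lemma entry_rows_tabloid_inv p T : entry_rows p T = map (@letter_row l') (tabloid_inv p T).
Proof.
apply: (@eq_from_nth _ (fun=> 0%N)); rewrite ?size_map ?size_iota // => j jp.
rewrite !(nth_map 0%N) ?size_iota //; apply/funext => J.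
have := @count_tabloid_inv l p T j (J - 1) jp.
rewrite [nth [::] (tabloid_inv p T) j](nth_map 0%N) ?size_iota // => e.
by rewrite (nth_map [::]) ?size_map ?size_iota // (nth_map 0%N) ?size_iota // /letter_row e
    nth_iota // add1n.
Qed.

Lemma dark_katabolizable mu (ws : seq (hecke l)) T : sorted geq mu -> size mu = size ws ->
  Tabloids l mu T -> katabolizable ws T <-> dark mu ws (tabloid_inv (size mu) T).
Proof.
move=> sm sz TT; rewrite (katabolizableP TT sz) (darkP _ sm sz) entry_rows_tabloid_inv.
(* The words for [w] and for its reverse are chosen separately by [repr]; up to reversal they agree
   only modulo the Hecke relations, which [kat_set] does not see. *)
have hcong (w : hecke l) : hecke_cong (repr w) (rev (repr (hecke_rev w))).
  apply: hecke_sym; rewrite -[X in hecke_cong _ X]revK; apply: hecke_cong_rev.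
  exact: hecke_repr_pi.
split=> [hK|[_ hK]].
  split; first exact: tabloid_inv_Bmu.
  apply: kat_set_height_le hK => // w; try exact: classical_residues.
  by have [] := hecke_cong_height_le (hcong w).
apply: kat_set_height_le hK => // w; try exact: classical_residues.
by have [] := hecke_cong_height_le (hcong w).
Qed.

Lemma dark_Bmu mu (ws : seq (hecke l)) b : sorted geq mu -> size mu = size ws ->
  dark mu ws b -> Bmu l mu b.
Proof. by move=> sm sz /(darkP _ sm sz)[]. Qed.

End Katabolism.

(** * The case of one letter, where no generator exists and [i + 1] would equal [i] *)

Section OneRow.

Lemma hecke1_repr (w : hecke 1) : repr w = [::].
Proof. by case: (repr w) => // -[]. Qed.

Lemma Bmu1P mu b : Bmu 1 mu b <-> b = [seq nseq m 1%N | m <- mu].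
Proof.
split.
  move=> [sb h]; apply: (@eq_from_nth _ [::]); rewrite ?size_map // => j; rewrite sb => jm.
  have /and3P[/eqP sj _ aj] := h _ jm; rewrite (nth_map 0%N) // -sj.
  apply/all_pred1P; apply: sub_all aj => a /=; lia.
move=> ->; split; first by rewrite size_map.
move=> j jm; rewrite (nth_map 0%N) // /is_B1 size_nseq eqxx all_nseq /= orbT andbT.
by case: (nth _ _ _) => //= n; elim: n => //= n ->.
Qed.

Lemma dark1P mu (ws : seq (hecke 1)) b : size mu = size ws -> dark mu ws b <-> Bmu 1 mu b.
Proof.
rewrite Bmu1P; elim: mu ws b => [|m mu IH] [|w ws] b //= [sz].
rewrite /Fset_hecke hecke1_repr /=.
have tauE : tau 1 [seq nseq m 1%N | m <- mu] = [seq nseq m 1%N | m <- mu].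
  rewrite /tau -map_comp; apply: eq_map => n /=; rewrite map_nseq /=.
  apply: sorted_sort; first exact: leq_trans.
  by case: n => //= n; elim: n => //= n ->.
split.
  by move=> [b1 [b0 /(IH _ _ sz) -> <-] <-]; rewrite tauE.
move=> ->; exists [seq nseq m 1%N | m <- mu] => //.
by exists [seq nseq m 1%N | m <- mu] => //; apply/(IH _ _ sz).
Qed.

Lemma katabolizable1 mu (ws : seq (hecke 1)) (T : tabloid 1) : Tabloids 1 mu T ->
  size mu = size ws -> katabolizable ws T.
Proof.
elim: mu ws T => [|m mu IH] [|w ws] T TT //=.
  move=> _; case: TT => /allP tT cT; apply/allP => r rT.
  apply/eqP; have /andP[_ /allP pr] := tT _ rT.
  case: r rT pr => // a r rT pr; have a0 := pr a (mem_head _ _).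
  have := cT a a0; rewrite nth_nil => /eqP; rewrite -leqn0 leqNgt -has_count.
  by move/hasP; case; exists a => //=; apply/flattenP; exists (a :: r) => //; exact: mem_head.
move=> [sz]; rewrite /P_hecke hecke1_repr /=; apply/andP; split.
  by apply/forallP => i; rewrite ord1 eqxx implybT.
by apply: IH => //; exact: kat_Tabloids TT.
Qed.

End OneRow.

Lemma content_tabloid_inv l mu (T : tabloid l) : Tabloids l mu T ->
  content l (tabloid_inv (size mu) T) = tabloid_shape T.
Proof.
move=> [/allP tT cT]; apply: (@eq_from_nth _ 0%N);
    rewrite ?size_map ?size_iota ?size_tuple // => i il.
rewrite (nth_map 0%N) ?size_iota // nth_iota // add1n (nth_map [::]) ?size_tuple //.
rewrite -[nth [::] T i]/(nth [::] T (Ordinal il)) nth_tabloid.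
set r := tnth T _.
have ar : all (fun a => 1 <= a <= size mu)%N r.
  have rT : r \in (T : seq _) by exact: mem_tnth.
  have /andP[_ /allP pr] := tT _ rT; apply/allP => a ar; have a0 := pr _ ar.
  rewrite a0 leqNgt /=; apply/negP => am; have := cT a a0.
  rewrite nth_default; last by rewrite -ltnS prednK.
  move/eqP; rewrite -leqn0 leqNgt -has_count => /hasP[]; exists a => //=.
  by apply/flattenP; exists r.
rewrite -(size_count_iota ar) count_flatten sumnE big_map (big_nth [::]) size_map size_iota
    big_mkord.
by apply: eq_bigr => j _; exact: (@count_tabloid_inv l _ T j (Ordinal il) (ltn_ord j)).
Qed.

Local Close Scope ring_scope.
Local Open Scope classical_set_scope.

Theorem theorem6p20 (l p : nat) (mu : p.-tuple nat) (w : p.-tuple (hecke l))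
    (hl : 0 < l) (hmu : sorted geq mu) :
  set_bij [set T : tabloid l | Tabloids l mu T /\ katabolizable w T]
          (dark mu w) (tabloid_inv p)
  /\ (forall T : tabloid l, Tabloids l mu T -> katabolizable w T ->
        content l (tabloid_inv p T) = tabloid_shape T).
Proof.
have sz : size mu = size w by rewrite !size_tuple.
have pE : p = size mu by rewrite size_tuple.
have [kd dB] : (forall T, Tabloids l mu T ->
    katabolizable w T <-> dark mu w (tabloid_inv (size mu) T)) /\
    (forall b, dark mu w b -> Bmu l mu b).
  (* For [l = 1] both sides are everything; residues are used only from two letters on. *)
  clear pE; case: l hl w sz => [//|[|l']] _ w' sz; split.
  - move=> T TT; rewrite dark1P //; split=> _; first exact: tabloid_inv_Bmu.
    exact: katabolizable1 TT sz.
  - by move=> b /(dark1P _ sz).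
  - by move=> T; exact: dark_katabolizable.
  - by move=> b; exact: dark_Bmu.
rewrite [in tabloid_inv p]pE; split; last by move=> T TT _; exact: content_tabloid_inv.
split=> [T [TT kT]|T T'|b db].
- exact/(kd _ TT).
- by rewrite !inE => -[TT _] [TT' _] e; rewrite -(tabloid_invK TT) e tabloid_invK.
have Bb := dB _ db; have TT := crystal_inv_Tabloids Bb.
exists (crystal_inv l b); last exact: crystal_invK.
by split=> //; apply/(kd _ TT); rewrite crystal_invK.
Qed.
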